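(* Let $\mathbb{T}$ and $\mathbb{T}'$ be single-sorted relational coherent theories. Suppose that every prime type of $\mathbb{T}$ is strictly realised in a countable, saturated model of $\mathbb{T}$, and that every prime type of $\mathbb{T}'$ is strictly realised in a countable, saturated model of $\mathbb{T}'$. Then the canonical extensions of their associated syntactic doctrines are isomorphic if and only if their categories of countable, saturated models are equivalent over $\mathbf{Set}$, i.e. $$D_{\mathbb{T}}^\delta \cong D_{\mathbb{T}'}^\delta \iff \omega\mathrm{Sat}(\mathbb{T}) \simeq_{\mathbf{Set}} \omega\mathrm{Sat}(\mathbb{T}').$$
   Context: Coherent formulae are built from atomic formulae (including equality) with $\wedge, \vee, \top, \bot, \exists$; a coherent theory is a set of sequents $\phi(x) \vdash \psi(x)$ between coherent formulae, interpreted as ''for all $x$, $\phi(x)$ implies $\psi(x)$''. All theories are single-sorted and relational (no function symbols). Morphisms of models are homomorphisms of structures. The syntactic doctrine $D_{\mathbb{T}} \colon \mathbf{FinSet} \to \mathbf{DL}$ ($\mathbf{DL}$ the category of bounded distributive lattices and bounded lattice morphisms) sends a finite set $X$ to the lattice of coherent formulae with free variables in $X$ modulo $\mathbb{T}$-provable equivalence, and a function to the corresponding substitution map. The canonical extension $L^\delta \supseteq L$ of a distributive lattice $L$ is the unique (up to isomorphism fixing $L$) completion of $L$ in which every element is a join of meets of subsets of $L$ and a meet of joins of subsets of $L$, and such that $\bigwedge S \leq \bigvee T$ with $S,T\subseteq L$ implies $\bigwedge S' \leq \bigvee T'$ for some finite $S'\subseteq S,T'\subseteq T$. A lattice morphism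 $f \colon L \to K$ extends uniquely to a map $f^\delta \colon L^\delta \to K^\delta$ preserving arbitrary joins and meets. $D_{\mathbb{T}}^\delta$ is the composite of $D_{\mathbb{T}}$ with the functor $(-)^\delta$, and $D_{\mathbb{T}}^\delta \cong D_{\mathbb{T}'}^\delta$ means that there is a natural isomorphism between these functors on $\mathbf{FinSet}$. A prime type of $\mathbb{T}$ (in a finite set of variables $X$) is a prime filter of $D_{\mathbb{T}}(X)$. It is strictly realised in a model $\mathcal{M}$ if it equals $\mathrm{tp}_{\mathcal{M}}(m) = \{\phi \in D_{\mathbb{T}}(X) : \mathcal{M} \models \phi(m)\}$ for some $m \in M^X$. For disjoint sets of variables $X,Y$, a $Y$-type with $X$-parameters in a model $\mathcal{M}$ with underlying set $M$ is a pair $(\tau,m)$, $\tau$ a set of coherent formulae with free variables in $X \cup Y$, considered closed under finite conjunctions, and $m \in M^X$. It is consistent if for every $\phi \in \tau$ there is $n \in M^Y$ with $\mathcal{M} \models \phi(m,n)$, and realised if there is $n \in M^Y$ with $\mathcal{M} \models \phi(m,n)$ for every $\phi \in \tau$. $\mathcal{M}$ is $\omega$-saturated if, for any finite $X,Y$, every consistent $Y$-type with $X$-parameters in $\mathcal{M}$ is realised. A model is countable and saturated if its underlying set is (at most) countable and it is $\omega$-saturated; $\omega\mathrm{Sat}(\mathbb{T})$ is the category of countable, saturated models of $\mathbb{T}$ and all model homomorphisms between them, equipped with its forgetful functor to $\mathbf{Set}$. Categories $\mathcal{A}, \mathcal{B}$ equipped with functors $A \colon \mathcal{A} \to \mathcal{E}$,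 $B \colon \mathcal{B} \to \mathcal{E}$ are equivalent over $\mathcal{E}$, written $\mathcal{A} \simeq_{\mathcal{E}} \mathcal{B}$, if there are functors $F \colon \mathcal{A} \to \mathcal{B}$, $G \colon \mathcal{B} \to \mathcal{A}$ witnessing an equivalence of categories and commuting with $A$ and $B$ (i.e. $B F = A$ and $A G = B$), so that $A$ and $B$ are equivalent as objects of the slice $\mathbf{CAT}/\mathcal{E}$. *)

(* Defs.v *)
From HB Require Import structures.
From mathcomp Require Import all_boot all_order.
From mathcomp Require Import boolp classical_sets functions cardinality.

Set Implicit Arguments.
Unset Strict Implicit.
Unset Printing Implicit Defensive.

Import Order.Theory.

Local Open Scope classical_set_scope.
Local Open Scope quotient_scope.

Record category := Category {
  ob :> Type;
  hom : ob -> ob -> Type;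
  idm : forall a, hom a a;
  compm : forall a b c, hom b c -> hom a b -> hom a c;
  compm1 : forall a b (f : hom a b), compm f (idm a) = f;
  comp1m : forall a b (f : hom a b), compm (idm b) f = f;
  compmA : forall a b c d (h : hom c d) (g : hom b c) (f : hom a b),
    compm h (compm g f) = compm (compm h g) f
}.

Record functor (A B : category) := Functor {
  fob :> A -> B;
  fmap : forall a b : A, hom a b -> hom (fob a) (fob b);
  fmap1 : forall a, fmap (idm a) = idm (fob a);
  fmapM : forall a b c (g : hom b c) (f : hom a b),
    fmap (compm g f) = compm (fmap g) (fmap f)
}.
Arguments fmap {A B} F {a b} : rename.

Definition idF (A : category) : functor A A :=
  @Functor A A id (fun a b => id) (fun=> erefl) (fun _ _ _ _ _ => erefl).

Section CompF.
Variables (A B C : category) (G : functor B C) (F : functor A B).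

Let compF_map a b (f : hom a b) := fmap G (fmap F f).

Fact compF1 a : compF_map (idm a) = idm (G (F a)).
Proof. by rewrite /compF_map !fmap1. Qed.

Fact compFM a b c (g : hom b c) (f : hom a b) :
  compF_map (compm g f) = compm (compF_map g) (compF_map f).
Proof. by rewrite /compF_map !fmapM. Qed.

Definition compF : functor A C := Functor compF1 compFM.
End CompF.

Definition naturally_isomorphic (A B : category) (F G : functor A B) : Prop :=
  exists (alpha : forall a, hom (F a) (G a)) (beta : forall a, hom (G a) (F a)),
    [/\ forall a b (f : hom a b),
          compm (alpha b) (fmap F f) = compm (fmap G f) (alpha a),
        forall a, compm (beta a) (alpha a) = idm (F a)
      & forall a, compm (alpha a) (beta a) = idm (G a)].

(* The commutations with U and V are strict equalities of functors. *)
Definition equivalent_over (E A B : category)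
    (U : functor A E) (V : functor B E) : Prop :=
  exists (F : functor A B) (G : functor B A),
    [/\ naturally_isomorphic (compF G F) (idF A),
        naturally_isomorphic (compF F G) (idF B),
        compF V F = U
      & compF U G = V].

Definition SET : category :=
  @Category Type (fun A B => A -> B) (fun A => id) (fun A B C g f => g \o f)
    (fun _ _ _ => erefl) (fun _ _ _ => erefl) (fun _ _ _ _ _ _ _ => erefl).

Definition FinSet : category :=
  @Category finType (fun X Y => X -> Y) (fun X => id) (fun X Y Z g f => g \o f)
    (fun _ _ _ => erefl) (fun _ _ _ => erefl) (fun _ _ _ _ _ _ _ => erefl).

(* Displays only affect notations; a single one is used for all lattices. *)
Fact lat_display : Order.disp_t. Proof. by []. Qed.

(* Order's {tblmorphism L -> K} is not enough here: it only asks for the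
   preservation of \bot and \top. *)
Record dl_hom (L K : tbDistrLatticeType lat_display) := DLHom {
  dl_fun :> L -> K;
  dl_meet : Order.meet_morphism dl_fun;
  dl_join : Order.join_morphism dl_fun;
  dl_bot : dl_fun \bot%O = \bot%O;
  dl_top : dl_fun \top%O = \top%O
}.

Section DLHomTheory.
Implicit Types L K : tbDistrLatticeType lat_display.

Lemma dl_hom_ext L K (f g : dl_hom L K) : f =1 g -> f = g.
Proof.
case: f g => [f f1 f2 f3 f4] [g g1 g2 g3 g4] /= /funext fg.
by subst g; congr DLHom; exact: Prop_irrelevance.
Qed.

Lemma dl_hom_le L K (f : dl_hom L K) x y : (x <= y -> f x <= f y)%O.
Proof.
by rewrite !leEmeet -dl_meet => /eqP ->.
Qed.

Definition dl_id L : dl_hom L L :=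
  @DLHom L L id (fun _ _ => erefl) (fun _ _ => erefl) erefl erefl.

Section Comp.
Variables (L K M : tbDistrLatticeType lat_display).
Variables (g : dl_hom K M) (f : dl_hom L K).

Fact dl_comp_meet : Order.meet_morphism (g \o f).
Proof. by move=> x y; rewrite /= !dl_meet. Qed.
Fact dl_comp_join : Order.join_morphism (g \o f).
Proof. by move=> x y; rewrite /= !dl_join. Qed.
Fact dl_comp_bot : (g \o f) \bot%O = \bot%O.
Proof. by rewrite /= !dl_bot. Qed.
Fact dl_comp_top : (g \o f) \top%O = \top%O.
Proof. by rewrite /= !dl_top. Qed.

Definition dl_comp : dl_hom L M :=
  DLHom dl_comp_meet dl_comp_join dl_comp_bot dl_comp_top.
End Comp.
End DLHomTheory.

Definition DL : category.
Proof.
apply: (@Category (tbDistrLatticeType lat_display) dl_hom dl_id dl_comp).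
- by move=> *; apply: dl_hom_ext.
- by move=> *; apply: dl_hom_ext.
- by move=> *; apply: dl_hom_ext.
Defined.

Section PrimeFilters.
Variable L : tbDistrLatticeType lat_display.

Definition lat_filter (F : set L) : Prop :=
  [/\ F \top%O, forall a b, F a -> (a <= b)%O -> F b
    & forall a b, F a -> F b -> F (a `&` b)%O].

Definition prime_filter (F : set L) : Prop :=
  [/\ lat_filter F, ~ F \bot%O
    & forall a b, F (a `|` b)%O -> F a \/ F b].

Definition lat_ideal (I : set L) : Prop :=
  [/\ I \bot%O, forall a b, I b -> (a <= b)%O -> I a
    & forall a b, I a -> I b -> I (a `|` b)%O].

Lemma prime_filter_separation (F I : set L) :
  lat_filter F -> lat_ideal I -> F `&` I = set0 ->
  exists P, [/\ prime_filter P, F `<=` P & P `&` I = set0].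
Proof.
move=> Ff [I0 Idown Ijoin] FI.
pose Z (A : set L) := A = set0 \/ [/\ lat_filter A, F `<=` A & A `&` I = set0].
have [C CZ Ctot|P [PZ Pmax]] := @Zorn_bigcup L Z.
  have [[X CX X0]|C0] := pselect (exists2 X, C X & X <> set0); last first.
    left; rewrite -subset0 => a [X CX Xa]; apply: C0; exists X => // X0.
    by rewrite X0 in Xa.
  have Zc Y a : C Y -> Y a -> [/\ lat_filter Y, F `<=` Y & Y `&` I = set0].
    by move=> CY Ya; case: (CZ Y CY) => // Y0; rewrite Y0 in Ya.
  have [[Xt _ _] FX _] : [/\ lat_filter X, F `<=` X & X `&` I = set0].
    by case: (CZ X CX).
  right; split.
  - split; first by exists X.
    + move=> a b [Y CY Ya] ab; exists Y => //.
      by have [[_ + _] _ _] := Zc _ _ CY Ya; apply; first exact: Ya.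
    + move=> a b [Y CY Ya] [W CW Wb].
      have [[_ _ Ym] _ _] := Zc _ _ CY Ya; have [[_ _ Wm] _ _] := Zc _ _ CW Wb.
      have [YW|WY] := Ctot _ _ CY CW.
        by exists W => //; apply: Wm => //; exact: YW.
      by exists Y => //; apply: Ym => //; exact: WY.
  - by move=> a Fa; exists X => //; exact: FX.
  - rewrite -subset0 => a [[Y CY Ya] Ia].
    by have [_ _ <-] := Zc _ _ CY Ya.
have [P0|[Pf FP PI]] := PZ.
  case: (Pmax F); last by right; split.
  rewrite P0; split; first exact: sub0set.
  by move=> /(_ \top%O); apply; case: Ff.
case: (Pf) => Pt Pup Pmeet.
have key a : ~ P a -> exists2 c, P c & I (c `&` a)%O.
  move=> nPa; apply: contrapT => nI.
  pose A := [set x | exists2 c, P c & (c `&` a <= x)%O].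
  have PA : P `<=` A.
    by move=> c Pc; exists c => //; exact: leIl.
  case: (Pmax A).
    split=> // AP; apply: nPa; apply: AP; exists \top%O => //.
    exact: leIr.
  right; split.
  - split; first by exists \top%O => //; exact: lex1.
    + by move=> x y [c Pc cx] xy; exists c => //; exact: le_trans xy.
    + move=> x y [c Pc cx] [c' Pc' cy]; exists (c `&` c')%O; first exact: Pmeet.
      rewrite lexI; apply/andP; split.
        apply: le_trans cx; apply: leI2 => //.
        exact: leIl.
      apply: le_trans cy; apply: leI2 => //.
      exact: leIr.
  - exact: subset_trans PA.
  - rewrite -subset0 => x [[c Pc cx] Ix]; apply: nI; exists c => //.
    exact: Idown Ix cx.
exists P; split=> //; split=> //.
  by move=> Pb; have : (P `&` I) \bot%O by []; rewrite PI.
move=> a b Pab; apply: contrapT => /not_orP[/key[c Pc Ica] /key[c' Pc' Icb]].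
have : (P `&` I) ((c `&` c') `&` (a `|` b))%O.
  split; first exact: Pmeet (Pmeet _ _ Pc Pc') Pab.
  apply: (Idown _ _ (Ijoin _ _ Ica Icb)).
  rewrite meetUr; apply: leU2.
    apply: leI2 => //; exact: leIl.
  apply: leI2 => //; exact: leIr.
by rewrite PI.
Qed.

End PrimeFilters.

Record complat := CompLat {
  cl_sort :> porderType lat_display;
  cl_sup : forall A : set cl_sort, supremums A !=set0;
  cl_inf : forall A : set cl_sort, infimums A !=set0
}.

Record complete_hom (C D : complat) := CompleteHom {
  ch_fun :> C -> D;
  ch_sup : forall A u, supremums A u -> supremums (ch_fun @` A) (ch_fun u);
  ch_inf : forall A u, infimums A u -> infimums (ch_fun @` A) (ch_fun u)
}.

Lemma complete_hom_ext C D (f g : complete_hom C D) : f =1 g -> f = g.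
Proof.
case: f g => [f f1 f2] [g g1 g2] /= /funext fg.
by subst g; congr CompleteHom; exact: Prop_irrelevance.
Qed.

Section CompleteHomComp.
Variables (C D E : complat).

Fact ch_id_sup (A : set C) u : supremums A u -> supremums (id @` A) (id u).
Proof. by rewrite image_id. Qed.
Fact ch_id_inf (A : set C) u : infimums A u -> infimums (id @` A) (id u).
Proof. by rewrite image_id. Qed.
Definition ch_id : complete_hom C C := CompleteHom ch_id_sup ch_id_inf.

Variables (g : complete_hom D E) (f : complete_hom C D).

Fact ch_comp_sup (A : set C) u :
  supremums A u -> supremums ((g \o f) @` A) ((g \o f) u).
Proof. by move=> /(ch_sup f)/(ch_sup g); rewrite image_comp. Qed.
Fact ch_comp_inf (A : set C) u :
  infimums A u -> infimums ((g \o f) @` A) ((g \o f) u).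
Proof. by move=> /(ch_inf f)/(ch_inf g); rewrite image_comp. Qed.
Definition ch_comp : complete_hom C E := CompleteHom ch_comp_sup ch_comp_inf.
End CompleteHomComp.

Definition CLat : category.
Proof.
apply: (@Category complat complete_hom ch_id ch_comp).
- by move=> *; apply: complete_hom_ext.
- by move=> *; apply: complete_hom_ext.
- by move=> *; apply: complete_hom_ext.
Defined.

(* A canonical extension is unique up to isomorphism over L, see
   [canonical_extension_unique]. *)
Record canonical_extension (L : tbDistrLatticeType lat_display) := CanExt {
  ce_lat :> complat;
  ce_emb : L -> ce_lat;
  ce_inj : injective ce_emb;
  ce_meet : forall a b,
    infimums [set ce_emb a; ce_emb b] (ce_emb (a `&` b)%O);
  ce_join : forall a b,
    supremums [set ce_emb a; ce_emb b] (ce_emb (a `|` b)%O);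
  ce_bot : supremums set0 (ce_emb \bot%O);
  ce_top : infimums set0 (ce_emb \top%O);
  ce_dense_join : forall u : ce_lat, exists2 V : set ce_lat, supremums V u &
    forall v, V v -> exists S : set L, infimums (ce_emb @` S) v;
  ce_dense_meet : forall u : ce_lat, exists2 V : set ce_lat, infimums V u &
    forall v, V v -> exists S : set L, supremums (ce_emb @` S) v;
  ce_compact : forall (S T : set L) s t,
    infimums (ce_emb @` S) s -> supremums (ce_emb @` T) t -> (s <= t)%O ->
    exists S' T' s' t',
      [/\ S' `<=` S /\ finite_set S', T' `<=` T /\ finite_set T',
          infimums (ce_emb @` S') s', supremums (ce_emb @` T') t'
        & (s' <= t')%O]
}.
Arguments ce_emb {L} c.

Section Uniqueness.
Variable L : tbDistrLatticeType lat_display.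
Implicit Types C D : canonical_extension L.

Lemma infimums_ge C (A : set C) i x :
  infimums A i -> (forall a, A a -> (x <= a)%O) -> (x <= i)%O.
Proof. by move=> [_ +] xA; apply => a /xA. Qed.

Lemma supremums_le C (A : set C) i x :
  supremums A i -> (forall a, A a -> (a <= x)%O) -> (i <= x)%O.
Proof. by move=> [_ +] xA; apply => a /xA. Qed.

Lemma ce_emb_le C a b : (ce_emb C a <= ce_emb C b)%O = (a <= b)%O.
Proof.
have mab := ce_meet C a b; apply/idP/idP => [ab|].
  rewrite leEmeet; apply/eqP/(@ce_inj _ C)/(is_subset1_infimums mab).
  split=> [_ [->|->] //|x xab]; by apply: xab; left.
rewrite leEmeet => /eqP E; rewrite -{1}E.
by case: mab => + _; apply; right.
Qed.

Lemma finite_infimums C D (S : set L) c : finite_set S ->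
  infimums (ce_emb C @` S) c -> exists2 a, c = ce_emb C a &
    infimums (ce_emb D @` S) (ce_emb D a).
Proof.
move=> /finite_seqP[l ->] Sc.
have key E : infimums (ce_emb E @` [set` l])
    (ce_emb E (\big[Order.meet / \top%O]_(a <- l) a)).
  elim: l {Sc} => [|a l [lb gr]]; first by rewrite big_nil set_nil image_set0; exact: ce_top.
  rewrite big_cons; have [mlb mgr] := ce_meet E a (\big[Order.meet / \top%O]_(a <- l) a).
  split=> [_ [b + <-]|x xb].
    rewrite /= inE => /orP[/eqP->|bl]; first by apply: mlb; left.
    by apply: (le_trans (mlb _ _)); [right; reflexivity|apply: lb; exists b].
  apply: mgr => _ [->|->].
    by apply: xb; exists a => //=; rewrite inE eqxx.
  by apply: gr => _ [b bl <-]; apply: xb; exists b => //=; rewrite inE bl orbT.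
by exists (\big[Order.meet / \top%O]_(a <- l) a) => //; apply: (is_subset1_infimums Sc).
Qed.

Lemma finite_supremums C D (S : set L) c : finite_set S ->
  supremums (ce_emb C @` S) c -> exists2 a, c = ce_emb C a &
    supremums (ce_emb D @` S) (ce_emb D a).
Proof.
move=> /finite_seqP[l ->] Sc.
have key E : supremums (ce_emb E @` [set` l])
    (ce_emb E (\big[Order.join / \bot%O]_(a <- l) a)).
  elim: l {Sc} => [|a l [ub gr]]; first by rewrite big_nil set_nil image_set0; exact: ce_bot.
  rewrite big_cons; have [mub mgr] := ce_join E a (\big[Order.join / \bot%O]_(a <- l) a).
  split=> [_ [b + <-]|x xb].
    rewrite /= inE => /orP[/eqP->|bl]; first by apply: mub; left.
    by apply: (le_trans _ (mub _ _)); [|right; reflexivity]; apply: ub; exists b.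
  apply: mgr => _ [->|->].
    by apply: xb; exists a => //=; rewrite inE eqxx.
  by apply: gr => _ [b bl <-]; apply: xb; exists b => //=; rewrite inE bl orbT.
by exists (\big[Order.join / \bot%O]_(a <- l) a) => //; apply: (is_subset1_supremums Sc).
Qed.

Lemma ce_transfer C D (S T : set L) c t d t' :
  infimums (ce_emb C @` S) c -> supremums (ce_emb C @` T) t ->
  infimums (ce_emb D @` S) d -> supremums (ce_emb D @` T) t' ->
  (c <= t)%O -> (d <= t')%O.
Proof.
move=> Sc Tt [Sd _] [Tt' _] ct.
have [S' [T' [s0 [t0 [[SS fS] [TT fT] Ss0 Tt0 st]]]]] := ce_compact Sc Tt ct.
have [a ac Da] := finite_infimums D fS Ss0; have [b bc Db] := finite_supremums D fT Tt0.
have ab : (a <= b)%O by rewrite -(ce_emb_le C) -ac -bc.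
apply: (@le_trans _ _ (ce_emb D a)).
  by apply: infimums_ge Da _ => _ [x S'x <-]; apply: Sd; exists x => //; exact: SS.
apply: (@le_trans _ _ (ce_emb D b)); first by rewrite ce_emb_le.
by apply: supremums_le Db _ => _ [x T'x <-]; apply: Tt'; exists x => //; exact: TT.
Qed.

Definition ce_match C D (u : C) (v : D) : Prop :=
  forall S c d, infimums (ce_emb C @` S) c -> infimums (ce_emb D @` S) d ->
    (c <= u)%O = (d <= v)%O.

Lemma ce_match_sym C D (u : C) (v : D) : ce_match u v -> ce_match v u.
Proof. by move=> uv S c d Sc Sd; rewrite (uv S d c). Qed.

Lemma ce_match_le C D (u u' : C) (v v' : D) :
  ce_match u v -> ce_match u' v' -> (u <= u')%O -> (v <= v')%O.
Proof.
move=> uv uv' uu'; have [V Vv VS] := ce_dense_join v.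
apply: supremums_le (Vv) _ => d Vd; have [S Sd] := VS d Vd.
have [c Sc] := cl_inf (ce_emb C @` S).
rewrite -(uv' S c d) //; apply: le_trans uu'; rewrite (uv S c d) //.
by have [+ _] := Vv; apply.
Qed.

Lemma ce_match_ex C D (u : C) : exists v : D, ce_match u v.
Proof.
pose A : set D := [set d | exists S c, [/\ infimums (ce_emb C @` S) c,
  infimums (ce_emb D @` S) d & (c <= u)%O]].
have [v Av] := cl_sup A; exists v => S c d Sc Sd; apply/idP/idP => [cu|dv].
  by case: Av => + _; apply; exists S, c.
have [V Vu VT] := ce_dense_meet u.
apply: infimums_ge (Vu) _ => w Vw; have [T Tw] := VT w Vw.
have [t Tt] := cl_sup (ce_emb D @` T).
apply: (ce_transfer Sd Tt Sc Tw); apply: le_trans dv _.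
apply: supremums_le (Av) _ => d' [S' [c' [Sc' Sd' c'u]]].
apply: (ce_transfer Sc' Tw Sd' Tt); apply: le_trans c'u _.
by case: Vu => + _; apply.
Qed.

Lemma ce_match_emb C D a : ce_match (ce_emb C a) (ce_emb D a).
Proof.
have key E F (S : set L) c d : infimums (ce_emb E @` S) c ->
    infimums (ce_emb F @` S) d -> (c <= ce_emb E a -> d <= ce_emb F a)%O.
  by move=> Sc Sd; apply: (@ce_transfer E F S [set a] c _ d _ Sc _ Sd);
    rewrite image_set1 supremums1.
by move=> S c d Sc Sd; apply/idP/idP; [exact: key Sc Sd|exact: key Sd Sc].
Qed.

Lemma canonical_extension_unique C D :
  exists (h : complete_hom C D) (g : complete_hom D C),
    [/\ cancel h g, cancel g h & forall a, h (ce_emb C a) = ce_emb D a].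
Proof.
have [h hP] := choice (@ce_match_ex C D).
have [g gP] := choice (@ce_match_ex D C).
have uniq (E F : canonical_extension L) (u : E) (v v' : F) : ce_match u v -> ce_match u v' -> v = v'.
  move=> uv uv'; apply/le_anti.
  by rewrite (ce_match_le uv uv') // (ce_match_le uv' uv).
have hK : cancel h g by move=> u; apply: uniq (gP _) (ce_match_sym (hP u)).
have gK : cancel g h by move=> u; apply: uniq (hP _) (ce_match_sym (gP u)).
have hle u u' : (u <= u')%O -> (h u <= h u')%O by apply: ce_match_le.
have gle u u' : (u <= u')%O -> (g u <= g u')%O by apply: ce_match_le.
have hs A u : supremums A u -> supremums (h @` A) (h u).
  move=> [ub lu]; split=> [_ [x Ax <-]|y hy]; first exact/hle/ub.
  by rewrite -[y]gK; apply/hle/lu => x Ax; rewrite -[x]hK; apply/gle/hy; exists x.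
have hi A u : infimums A u -> infimums (h @` A) (h u).
  move=> [lb ul]; split=> [_ [x Ax <-]|y hy]; first exact/hle/lb.
  by rewrite -[y]gK; apply/hle/ul => x Ax; rewrite -[x]hK; apply/gle/hy; exists x.
have gs A u : supremums A u -> supremums (g @` A) (g u).
  move=> [ub lu]; split=> [_ [x Ax <-]|y hy]; first exact/gle/ub.
  by rewrite -[y]hK; apply/gle/lu => x Ax; rewrite -[x]gK; apply/hle/hy; exists x.
have gi A u : infimums A u -> infimums (g @` A) (g u).
  move=> [lb ul]; split=> [_ [x Ax <-]|y hy]; first exact/gle/lb.
  by rewrite -[y]hK; apply/gle/ul => x Ax; rewrite -[x]gK; apply/hle/hy; exists x.
exists (CompleteHom hs hi), (CompleteHom gs gi); split=> // a /=.
exact: (uniq _ _ _ _ _ (hP _) (@ce_match_emb C D a)).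
Qed.

End Uniqueness.

(* A concrete canonical extension of L: the up-sets of its prime filters,
   ordered by inclusion, with a |-> {P | a \in P}. *)
#[local] Obligation Tactic := idtac.

Section UpSets.
Variable L : tbDistrLatticeType lat_display.

Record upset := UpSet {
  up_set :> set (set L);
  up_prime : up_set `<=` @prime_filter L;
  up_closed : forall P Q, prime_filter Q -> P `<=` Q -> up_set P -> up_set Q
}.

Lemma upset_inj : injective up_set.
Proof.
case=> [U U1 U2] [V V1 V2] /= UV; subst V.
by congr UpSet; exact: Prop_irrelevance.
Qed.

HB.instance Definition _ := gen_eqMixin upset.
HB.instance Definition _ := gen_choiceMixin upset.

Definition up_le (U V : upset) : bool := `[< U `<=` V >].

Fact up_le_refl : reflexive up_le.
Proof. by move=> U; apply/asboolP. Qed.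
Fact up_le_anti : antisymmetric up_le.
Proof.
move=> U V /andP[/asboolP UV /asboolP VU]; apply: upset_inj.
by apply/seteqP; split.
Qed.
Fact up_le_trans : transitive up_le.
Proof.
move=> V U W /asboolP UV /asboolP VW; apply/asboolP; exact: subset_trans VW.
Qed.

HB.instance Definition _ := Order.Le_isPOrder.Build lat_display upset
  up_le_refl up_le_anti up_le_trans.

Lemma up_leP (U V : upset) : reflect (U `<=` V) (U <= V)%O.
Proof. exact: asboolP. Qed.

Program Definition up_join (A : set upset) : upset :=
  @UpSet (\bigcup_(U in A) U) _ _.
Next Obligation. by move=> A P [U _ /up_prime]. Qed.
Next Obligation.
by move=> A P Q Qp PQ [U AU UP]; exists U => //; exact: up_closed UP.
Qed.

Program Definition up_meet (A : set upset) : upset :=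
  @UpSet (@prime_filter L `&` \bigcap_(U in A) U) _ _.
Next Obligation. by move=> A P []. Qed.
Next Obligation.
move=> A P Q Qp PQ [_ AP]; split=> // U AU; exact: up_closed (AP U AU).
Qed.

Lemma up_joinP (A : set upset) U : supremums A U <-> U = up_join A.
Proof.
have sA : supremums A (up_join A).
  split=> [V AV|V AV]; first by apply/up_leP => P VP; exists V.
  by apply/up_leP => P [W AW WP]; move/up_leP: (AV _ AW); exact.
split=> [AU|->//]; exact: (is_subset1_supremums AU sA).
Qed.

Lemma up_meetP (A : set upset) U : infimums A U <-> U = up_meet A.
Proof.
have sA : infimums A (up_meet A).
  split=> [V AV|V AV]; first by apply/up_leP => P [_]; exact.
  apply/up_leP => P VP; split; first exact: up_prime VP.
  by move=> W AW; move/up_leP: (AV _ AW); exact.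
split=> [AU|->//]; exact: (is_subset1_infimums AU sA).
Qed.

Fact up_sup (A : set upset) : supremums A !=set0.
Proof. by exists (up_join A); apply/up_joinP. Qed.
Fact up_inf (A : set upset) : infimums A !=set0.
Proof. by exists (up_meet A); apply/up_meetP. Qed.

Definition up_complat : complat := CompLat up_sup up_inf.

Program Definition up_emb (a : L) : upset :=
  @UpSet [set P | prime_filter P /\ P a] _ _.
Next Obligation. by move=> a P []. Qed.
Next Obligation. by move=> a P Q Qp PQ [_ /PQ]. Qed.

Lemma principal_filter (a : L) : lat_filter [set x | (a <= x)%O].
Proof.
split=> /= [|x y ax xy|x y ax ay]; first exact: lex1.
- exact: le_trans xy.
- by rewrite lexI ax.
Qed.

Lemma principal_ideal (a : L) : lat_ideal [set x | (x <= a)%O].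
Proof.
split=> /= [|x y ya xy|x y ax ay]; first exact: le0x.
- exact: le_trans ya.
- by rewrite leUx ax.
Qed.

Lemma up_emb_le a b : (up_emb a <= up_emb b)%O = (a <= b)%O.
Proof.
apply/idP/idP => [/up_leP ab|ab]; last first.
  apply/up_leP => P [Pp Pa]; split=> //.
  by case: (Pp) => -[_ Pu _] _ _; exact: Pu Pa ab.
apply: contrapT => nab.
have [|P [Pp aP Pb]] := prime_filter_separation (principal_filter a) (principal_ideal b).
  by rewrite -subset0 => x [/= ax xb]; apply: nab; exact: le_trans xb.
have [|_ Pb'] := ab P; first by split=> //; exact: aP (lexx a).
have : (P `&` [set x | (x <= b)%O]) b by split=> //=.
by rewrite Pb.
Qed.

Fact up_emb_inj : injective up_emb.
Proof. by move=> a b ab; apply/eqP; rewrite eq_le -!up_emb_le ab lexx. Qed.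

Fact up_emb_meet a b : infimums [set up_emb a; up_emb b] (up_emb (a `&` b)%O).
Proof.
apply/up_meetP/upset_inj/seteqP; split=> P [Pp].
  move=> Pab; split=> // U [->|->]; split=> //; case: (Pp) => -[_ Pu _] _ _.
    exact: Pu Pab (leIl _ _).
  exact: Pu Pab (leIr _ _).
move=> UP; split=> //; case: (Pp) => -[_ _ Pm] _ _; apply: Pm.
  by have [|] := UP (up_emb a); first by left.
by have [|] := UP (up_emb b); first by right.
Qed.

Fact up_emb_join a b : supremums [set up_emb a; up_emb b] (up_emb (a `|` b)%O).
Proof.
apply/up_joinP/upset_inj/seteqP; split=> P.
  move=> [Pp Pab]; case: (Pp) => _ _ /(_ _ _ Pab)[Pa|Pb].
    by exists (up_emb a); [left|].
  by exists (up_emb b); [right|].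
move=> [U UE UP]; have Pp := up_prime UP; split=> //.
case: (Pp) => -[_ Pu _] _ _; case: UE UP => -> [_ Px].
  exact: Pu Px (leUl _ _).
exact: Pu Px (leUr _ _).
Qed.

Fact up_emb_bot : supremums set0 (up_emb \bot%O).
Proof.
apply/up_joinP/upset_inj/seteqP; split=> P; last by case.
by move=> [[_ P0 _] /P0].
Qed.

Fact up_emb_top : infimums set0 (up_emb \top%O).
Proof.
apply/up_meetP/upset_inj/seteqP; split=> P [Pp _]; split=> //.
by case: Pp => -[].
Qed.

Fact up_dense_join (U : upset) : exists2 V : set upset, supremums V U &
  forall v, V v -> exists S : set L, infimums (up_emb @` S) v.
Proof.
exists [set V : upset | V `<=` U /\ exists S : set L, infimums (up_emb @` S) V];
  last by move=> V [].
apply/up_joinP/upset_inj/seteqP; split=> P; last by move=> [V [+ _]]; exact.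
move=> UP; exists (up_meet (up_emb @` P)); last first.
  by split; [exact: up_prime UP|move=> _ [a Pa <-]; split=> //; exact: up_prime UP].
split; last by exists P; apply/up_meetP.
move=> Q [Qp QP]; apply: up_closed UP => // a Pa.
by have [|] := QP (up_emb a); first by exists a.
Qed.

Fact up_dense_meet (U : upset) : exists2 V : set upset, infimums V U &
  forall v, V v -> exists S : set L, supremums (up_emb @` S) v.
Proof.
exists [set V : upset | U `<=` V /\ exists S : set L, supremums (up_emb @` S) V];
  last by move=> V [].
apply/up_meetP/upset_inj/seteqP; split=> P.
  by move=> UP; split; [exact: up_prime UP|move=> V [UV _]; exact: UV].
move=> [Pp PV]; apply: contrapT => nUP.
have [|_ [a nPa <-] [_ //]] := PV (up_join (up_emb @` (~` P))).
split; last by exists (~` P); apply/up_joinP.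
move=> Q UQ; apply: contrapT => nQ; apply: nUP; apply: up_closed (UQ) => // a Qa.
apply: contrapT => nPa; apply: nQ; exists (up_emb a); first by exists a.
by split=> //; exact: up_prime UQ.
Qed.

Fact up_compact (S T : set L) (s t : upset) :
  infimums (up_emb @` S) s -> supremums (up_emb @` T) t -> (s <= t)%O ->
  exists S' T' s' t',
    [/\ S' `<=` S /\ finite_set S', T' `<=` T /\ finite_set T',
        infimums (up_emb @` S') s', supremums (up_emb @` T') t'
      & (s' <= t')%O].
Proof.
move=> /up_meetP -> /up_joinP -> /up_leP st; apply: contrapT => nfin.
pose F : set L := [set x : L | exists l : seq L, [set` l] `<=` S /\
  (\big[Order.meet / \top%O]_(a <- l) a <= x)%O].
pose I : set L := [set x : L | exists l : seq L, [set` l] `<=` T /\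
  (x <= \big[Order.join / \bot%O]_(a <- l) a)%O].
have catS (A : set L) (l l' : seq L) :
    [set` l] `<=` A -> [set` l'] `<=` A -> [set` (l ++ l')] `<=` A.
  by move=> lA l'A a /=; rewrite mem_cat => /orP[/lA|/l'A].
have Ff : lat_filter F.
  split.
  - by exists [::]; split=> //; rewrite big_nil.
  - by move=> x y [l [lS lx]] xy; exists l; split=> //; exact: le_trans xy.
  - move=> x y [l [lS lx]] [l' [lS' ly]]; exists (l ++ l'); split; first exact: catS.
    by rewrite big_cat; apply: leI2.
have Ii : lat_ideal I.
  split.
  - by exists [::]; split=> //; rewrite big_nil.
  - by move=> x y [l [lT ly]] xy; exists l; split=> //; exact: le_trans ly.
  - move=> x y [l [lT lx]] [l' [lT' ly]]; exists (l ++ l'); split; first exact: catS.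
    by rewrite big_cat; apply: leU2.
have [|P [Pp FP PI]] := prime_filter_separation Ff Ii.
  rewrite -subset0 => x [[l [lS lx]] [l' [lT xl']]]; apply: nfin.
  exists [set` l], [set` l'], (up_meet (up_emb @` [set` l])),
    (up_join (up_emb @` [set` l'])); split.
  - by split=> //; exact: finite_seq.
  - by split=> //; exact: finite_seq.
  - exact/up_meetP.
  - exact/up_joinP.
  apply/up_leP => P [Pp Pl].
  have Pmeet : P (\big[Order.meet / \top%O]_(a <- l) a).
    case: (Pp) => -[Pt _ Pm] _ _; rewrite big_seq.
    elim/big_ind : _ => // a al.
    by have [|] := Pl (up_emb a); first by exists a.
  have : P (\big[Order.join / \bot%O]_(a <- l') a).
    by case: (Pp) => -[_ Pu _] _ _; apply: Pu Pmeet (le_trans lx xl').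
  have : [set` l'] `<=` [set` l'] by [].
  rewrite {1 2}/mkset.
  elim: {1 3}l' => [|a k IH] kl'; first by rewrite big_nil; case: Pp.
  rewrite big_cons => Pak; case: (Pp) => _ _ /(_ _ _ Pak)[Pa|]; last first.
    by apply: IH => b bk; apply: kl'; rewrite inE bk orbT.
  exists (up_emb a) => //; exists a => //.
  by apply: kl'; rewrite inE eqxx.
have [|_ [a Ta <-] [_ Pa]] := st P.
  split=> // _ [a Sa <-]; split=> //; apply: FP; exists [:: a]; split.
    by move=> b /=; rewrite inE => /eqP->.
  by rewrite big_seq1.
have : (P `&` I) a.
  split=> //; exists [:: a]; split; first by move=> b /=; rewrite inE => /eqP->.
  by rewrite big_seq1.
by rewrite PI.
Qed.

Definition canext : canonical_extension L :=
  @CanExt L up_complat up_emb up_emb_inj up_emb_meet up_emb_join up_emb_bot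
    up_emb_top up_dense_join up_dense_meet up_compact.

End UpSets.

Section CanExtMap.
Variables (L K : tbDistrLatticeType lat_display) (f : dl_hom L K).

Lemma prime_filter_preimage (P : set K) :
  prime_filter P -> prime_filter (f @^-1` P).
Proof.
move=> [[Pt Pu Pm] P0 Pj]; split; [split|..] => /=.
- by rewrite dl_top.
- by move=> a b Pa ab; apply: Pu Pa (dl_hom_le f ab).
- by move=> a b Pa Pb; rewrite dl_meet; exact: Pm.
- by rewrite dl_bot.
- by move=> a b; rewrite dl_join; exact: Pj.
Qed.

Program Definition canext_fun (U : canext L) : canext K :=
  @UpSet K [set Q | prime_filter Q /\ up_set U (f @^-1` Q)] _ _.
Next Obligation. by move=> U Q []. Qed.
Next Obligation.
move=> U P Q Qp PQ [_ UP]; split=> //.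
by apply: up_closed UP; [exact: prime_filter_preimage|move=> a /PQ].
Qed.

Fact canext_fun_sup (A : set (canext L)) u :
  supremums A u -> supremums (canext_fun @` A) (canext_fun u).
Proof.
move=> /up_joinP->; apply/up_joinP/upset_inj/seteqP; split=> Q.
  by move=> [Qp [U AU UQ]]; exists (canext_fun U) => //; exists U.
by move=> [_ [U AU <-] [Qp UQ]]; split=> //; exists U.
Qed.

Fact canext_fun_inf (A : set (canext L)) u :
  infimums A u -> infimums (canext_fun @` A) (canext_fun u).
Proof.
move=> /up_meetP->; apply/up_meetP/upset_inj/seteqP; split=> Q [Qp].
  by move=> [_ AQ]; split=> // _ [U AU <-]; split=> //; exact: AQ.
move=> AQ; split=> //; split; first exact: prime_filter_preimage.
by move=> U AU; have [|] := AQ (canext_fun U); first by exists U.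
Qed.

Definition canext_map : complete_hom (canext L) (canext K) :=
  CompleteHom canext_fun_sup canext_fun_inf.

Lemma canext_map_emb a : canext_map (ce_emb (canext L) a) = ce_emb (canext K) (f a).
Proof.
apply/upset_inj/seteqP; split=> Q [Qp]; first by case.
by move=> Qfa; split=> //; split=> //; exact: prime_filter_preimage.
Qed.

Lemma canext_map_unique (g : complete_hom (canext L) (canext K)) :
  (forall a, g (ce_emb (canext L) a) = ce_emb (canext K) (f a)) ->
  g = canext_map.
Proof.
move=> gf; apply: complete_hom_ext => u.
have [V Vu VS] := ce_dense_join u.
apply: (is_subset1_supremums (ch_sup g Vu)).
suff -> : g @` V = canext_map @` V by exact: ch_sup.
apply: eq_imagel => v /VS[S Sv].
apply: (is_subset1_infimums (ch_inf g Sv)).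
suff -> : g @` (ce_emb (canext L) @` S) = canext_map @` (ce_emb (canext L) @` S).
  exact: ch_inf.
by apply: eq_imagel => _ [a _ <-]; rewrite gf canext_map_emb.
Qed.

End CanExtMap.

Definition canextF : functor DL CLat.
Proof.
apply: (@Functor DL CLat (fun L => canext L) (@canext_map)).
- move=> L; apply: complete_hom_ext => U; apply/upset_inj/seteqP.
  by split=> [P []|P UP] //; split=> //; exact: up_prime UP.
- move=> L K M g f; apply: complete_hom_ext => U; apply/upset_inj/seteqP.
  split=> P; last by move=> [Pp []].
  by move=> [Pp UP]; split=> //; split=> //; exact: prime_filter_preimage.
Defined.

Record signature := Signature { sym :> Type; arity : sym -> nat }.

(* The context X is a type of variables; a quantifier binds the variable None
   of the context option X. *)
Inductive formula (S : signature) (X : Type) : Type :=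
| Rel (r : S) of ('I_(arity r) -> X)
| Eq of X & X
| Top
| Bot
| And of formula S X & formula S X
| Or of formula S X & formula S X
| Ex of formula S (option X).
Arguments Top {S X}.
Arguments Bot {S X}.

Fixpoint subst (S : signature) (X Y : Type) (f : X -> Y) (phi : formula S X) :
    formula S Y :=
  match phi with
  | Rel r v => Rel (f \o v)
  | Eq x y => Eq S (f x) (f y)
  | Top => Top
  | Bot => Bot
  | And phi psi => And (subst f phi) (subst f psi)
  | Or phi psi => Or (subst f phi) (subst f psi)
  | Ex phi => Ex (subst (omap f) phi)
  end.

Lemma subst_id (S : signature) X (phi : formula S X) : subst id phi = phi.
Proof.
elim: phi => //= {X} [X phi -> psi ->//|X phi -> psi ->//|X phi {2}<-].
by congr (Ex (subst _ _)); apply: funext => -[].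
Qed.

Lemma subst_comp (S : signature) X Y Z (g : Y -> Z) (f : X -> Y)
    (phi : formula S X) :
  subst g (subst f phi) = subst (g \o f) phi.
Proof.
elim: phi Y Z g f => //= {X}.
- by move=> X phi IH psi IH' Y Z g f; rewrite IH IH'.
- by move=> X phi IH psi IH' Y Z g f; rewrite IH IH'.
- move=> X phi IH Y Z g f; rewrite IH.
  by congr (Ex (subst _ _)); apply: funext => -[].
Qed.

Record sequent (S : signature) := Sequent {
  ctx : finType;
  lhs : formula S ctx;
  rhs : formula S ctx
}.

Definition theory (S : signature) := sequent S -> Prop.

Section Provability.
Variables (S : signature) (T : theory S).

(* [pr_leibniz] replaces x by y at the variable None of phi. *)
Inductive proves : forall X : finType, formula S X -> formula S X -> Prop :=
| pr_axiom s : T s -> proves (lhs s) (rhs s)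
| pr_id (X : finType) (phi : formula S X) : proves phi phi
| pr_cut (X : finType) (phi psi chi : formula S X) :
    proves phi psi -> proves psi chi -> proves phi chi
| pr_subst (X Y : finType) (f : X -> Y) (phi psi : formula S X) :
    proves phi psi -> proves (subst f phi) (subst f psi)
| pr_refl (X : finType) (x : X) : proves Top (Eq S x x)
| pr_leibniz (X : finType) (x y : X) (phi : formula S (option X)) :
    proves (And (Eq S x y) (subst (oapp id x) phi)) (subst (oapp id y) phi)
| pr_top (X : finType) (phi : formula S X) : proves phi Top
| pr_andl (X : finType) (phi psi : formula S X) : proves (And phi psi) phi
| pr_andr (X : finType) (phi psi : formula S X) : proves (And phi psi) psi
| pr_and (X : finType) (phi psi chi : formula S X) :
    proves phi psi -> proves phi chi -> proves phi (And psi chi)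
| pr_bot (X : finType) (phi : formula S X) : proves Bot phi
| pr_orl (X : finType) (phi psi : formula S X) : proves phi (Or phi psi)
| pr_orr (X : finType) (phi psi : formula S X) : proves psi (Or phi psi)
| pr_or (X : finType) (phi psi chi : formula S X) :
    proves phi chi -> proves psi chi -> proves (Or phi psi) chi
| pr_distr (X : finType) (phi psi chi : formula S X) :
    proves (And phi (Or psi chi)) (Or (And phi psi) (And phi chi))
| pr_ex (X : finType) (phi : formula S (option X : finType))
    (psi : formula S X) :
    proves phi (subst Some psi : formula S (option X : finType)) ->
    proves (Ex phi) psi
| pr_ex_inv (X : finType) (phi : formula S (option X : finType))
    (psi : formula S X) :
    proves (Ex phi) psi ->
    proves phi (subst Some psi : formula S (option X : finType))
| pr_frobenius (X : finType) (phi : formula S X) (psi : formula S (option X)) :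
    proves (And phi (Ex psi)) (Ex (And (subst Some phi) psi)).

End Provability.

HB.instance Definition _ (S : signature) (X : Type) :=
  gen_eqMixin (formula S X).
HB.instance Definition _ (S : signature) (X : Type) :=
  gen_choiceMixin (formula S X).

Section Doctrine.
Variables (S : signature) (T : theory S).

Section Fiber.
Variable X : finType.
Implicit Types phi psi : formula S X.

Definition prov_equiv phi psi : bool := `[< proves T phi psi /\ proves T psi phi >].

Fact prov_equiv_refl : reflexive prov_equiv.
Proof. by move=> phi; apply/asboolP; split; exact: pr_id. Qed.
Fact prov_equiv_sym : symmetric prov_equiv.
Proof. by move=> phi psi; apply/asboolP/asboolP => -[]. Qed.
Fact prov_equiv_trans : transitive prov_equiv.
Proof.
move=> psi phi chi /asboolP[pq qp] /asboolP[qr rq].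
by apply/asboolP; split; [exact: pr_cut pq qr|exact: pr_cut rq qp].
Qed.

Canonical prov_equiv_equiv :=
  EquivRel prov_equiv prov_equiv_refl prov_equiv_sym prov_equiv_trans.

Definition doctrine_fiber := {eq_quot prov_equiv}.
HB.instance Definition _ := EqQuotient.on doctrine_fiber.
HB.instance Definition _ := Choice.on doctrine_fiber.

Implicit Types a b c : doctrine_fiber.

Definition class phi : doctrine_fiber := \pi phi.

Lemma class_eq phi psi :
  class phi = class psi <-> proves T phi psi /\ proves T psi phi.
Proof. by split=> [/eqmodP/asboolP//|pq]; apply/eqmodP/asboolP. Qed.

Lemma classK a : class (repr a) = a.
Proof. exact: reprK. Qed.

Lemma repr_class phi :
  proves T (repr (class phi)) phi /\ proves T phi (repr (class phi)).
Proof. by apply/class_eq; rewrite classK. Qed.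

Definition df_le a b : bool := `[< proves T (repr a) (repr b) >].
Definition df_meet a b := class (And (repr a) (repr b)).
Definition df_join a b := class (Or (repr a) (repr b)).

Lemma df_leP phi psi : reflect (proves T phi psi) (df_le (class phi) (class psi)).
Proof.
have [pr rp] := repr_class phi; have [qr rq] := repr_class psi.
apply: (iffP (asboolP _)) => [pq|pq].
  exact: pr_cut rp (pr_cut pq qr).
exact: pr_cut pr (pr_cut pq rq).
Qed.

Fact df_le_refl : reflexive df_le.
Proof. by move=> a; apply/asboolP; exact: pr_id. Qed.
Fact df_le_anti : antisymmetric df_le.
Proof.
move=> a b /andP[/asboolP ab /asboolP ba].
by rewrite -(classK a) -(classK b); apply/class_eq.
Qed.
Fact df_le_trans : transitive df_le.
Proof. by move=> b a c /asboolP ab /asboolP bc; apply/asboolP; exact: pr_cut bc. Qed.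

HB.instance Definition _ := Order.Le_isPOrder.Build lat_display doctrine_fiber
  df_le_refl df_le_anti df_le_trans.

Lemma class_le phi psi : (class phi <= class psi)%O <-> proves T phi psi.
Proof. by split=> [/df_leP|pq]; last exact/df_leP. Qed.

Lemma le_class a phi : (a <= class phi)%O <-> proves T (repr a) phi.
Proof. by rewrite -{1}[a]classK; exact: class_le. Qed.

Lemma class_ge phi b : (class phi <= b)%O <-> proves T phi (repr b).
Proof. by rewrite -{1}[b]classK; exact: class_le. Qed.

Lemma le_repr a b : (a <= b)%O <-> proves T (repr a) (repr b).
Proof. by rewrite -{1}[b]classK; exact: le_class. Qed.

Fact df_meetP a b c : (a <= df_meet b c)%O = (a <= b)%O && (a <= c)%O.
Proof.
apply/idP/andP => [/le_class abc|[/le_repr ab /le_repr ac]].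
  split; apply/le_repr; apply: pr_cut abc _; [exact: pr_andl|exact: pr_andr].
by apply/le_class; exact: pr_and.
Qed.

Fact df_joinP a b c : (df_join a b <= c)%O = (a <= c)%O && (b <= c)%O.
Proof.
apply/idP/andP => [/class_ge abc|[/le_repr ac /le_repr bc]].
  split; apply/le_repr; apply: pr_cut abc; [exact: pr_orl|exact: pr_orr].
by apply/class_ge; exact: pr_or.
Qed.

HB.instance Definition _ := Order.POrder_MeetJoin_isLattice.Build lat_display
  doctrine_fiber df_meetP df_joinP.

Lemma class_and phi psi : class (And phi psi) = (class phi `&` class psi)%O.
Proof.
apply/le_anti/andP; split.
  by rewrite lexI; apply/andP; split; apply/class_le; [exact: pr_andl|exact: pr_andr].
have [pr rp] := repr_class phi; have [qr rq] := repr_class psi.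
apply/class_le/pr_and; first exact: pr_cut (pr_andl _ _ _) pr.
exact: pr_cut (pr_andr _ _ _) qr.
Qed.

Lemma class_or phi psi : class (Or phi psi) = (class phi `|` class psi)%O.
Proof.
apply/le_anti/andP; split; last first.
  by rewrite leUx; apply/andP; split; apply/class_le; [exact: pr_orl|exact: pr_orr].
have [pr rp] := repr_class phi; have [qr rq] := repr_class psi.
apply/class_le/pr_or; first exact: pr_cut rp (pr_orl _ _ _).
exact: pr_cut rq (pr_orr _ _ _).
Qed.

Fact df_meetUl : @left_distributive doctrine_fiber _ Order.meet Order.join.
Proof.
move=> a b c; rewrite -[a]classK -[b]classK -[c]classK.
rewrite meetC -(class_or (repr a)) -(class_and (repr c)).
rewrite -(class_and (repr a)) -(class_and (repr b)) -(class_or (And _ _)).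
apply/class_eq; split.
  apply: pr_cut (pr_distr _ _ _ _) _; apply: pr_or.
    apply: pr_cut (pr_orl _ _ _); apply: pr_and; [exact: pr_andr|exact: pr_andl].
  apply: pr_cut (pr_orr _ _ _); apply: pr_and; [exact: pr_andr|exact: pr_andl].
apply: pr_or; apply: pr_and; try exact: pr_andr.
  exact: pr_cut (pr_andl _ _ _) (pr_orl _ _ _).
exact: pr_cut (pr_andl _ _ _) (pr_orr _ _ _).
Qed.

HB.instance Definition _ := Order.Lattice_Meet_isDistrLattice.Build lat_display
  doctrine_fiber df_meetUl.

Fact df_bot a : (class Bot <= a)%O.
Proof. by rewrite -[a]classK; apply/class_le; exact: pr_bot. Qed.
Fact df_top a : (a <= class Top)%O.
Proof. by rewrite -[a]classK; apply/class_le; exact: pr_top. Qed.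

HB.instance Definition _ :=
  Order.hasBottom.Build lat_display doctrine_fiber df_bot.
HB.instance Definition _ :=
  Order.hasTop.Build lat_display doctrine_fiber df_top.

End Fiber.

Definition doctrine_fun (X Y : finType) (f : X -> Y) (a : doctrine_fiber X) :
  doctrine_fiber Y := class (subst f (repr a)).

Lemma doctrine_fun_class (X Y : finType) (f : X -> Y) (phi : formula S X) :
  doctrine_fun f (class phi) = class (subst f phi).
Proof. by apply/class_eq; split; apply: pr_subst; case: (repr_class phi). Qed.

Section Subst.
Variables (X Y : finType) (f : X -> Y).

Fact doctrine_fun_meet : Order.meet_morphism (@doctrine_fun X Y f).
Proof.
move=> a b; rewrite -[a]classK -[b]classK -class_and !doctrine_fun_class.
by rewrite -class_and.
Qed.
Fact doctrine_fun_join : Order.join_morphism (@doctrine_fun X Y f).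
Proof.
move=> a b; rewrite -[a]classK -[b]classK -class_or !doctrine_fun_class.
by rewrite -class_or.
Qed.
Fact doctrine_fun_bot : doctrine_fun f \bot%O = \bot%O.
Proof. exact: (doctrine_fun_class f Bot). Qed.
Fact doctrine_fun_top : doctrine_fun f \top%O = \top%O.
Proof. exact: (doctrine_fun_class f Top). Qed.

Definition doctrine_map : dl_hom (doctrine_fiber X) (doctrine_fiber Y) :=
  DLHom doctrine_fun_meet doctrine_fun_join doctrine_fun_bot doctrine_fun_top.
End Subst.

Definition doctrine : functor FinSet DL.
Proof.
apply: (@Functor FinSet DL (fun X => doctrine_fiber X) doctrine_map).
- move=> X; apply: dl_hom_ext => a.
  by rewrite -[a]classK /= doctrine_fun_class subst_id.
- move=> X Y Z g f; apply: dl_hom_ext => a.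
  by rewrite -[a]classK /= !doctrine_fun_class subst_comp.
Defined.

Definition doctrine_delta : functor FinSet CLat := compF canextF doctrine.

End Doctrine.

Record structure (S : signature) := Structure {
  carrier :> Type;
  interp : forall r : S, ('I_(arity r) -> carrier) -> Prop
}.

Fixpoint sat (S : signature) (M : structure S) (X : Type) (phi : formula S X) :
    (X -> M) -> Prop :=
  match phi with
  | Rel r v => fun m => interp (m \o v)
  | Eq x y => fun m => m x = m y
  | Top => fun=> True
  | Bot => fun=> False
  | And phi psi => fun m => sat phi m /\ sat psi m
  | Or phi psi => fun m => sat phi m \/ sat psi m
  | Ex phi => fun m => exists a, sat phi (oapp m a)
  end.

Definition models (S : signature) (T : theory S) (M : structure S) : Prop :=
  forall s, T s -> forall m : ctx s -> M, sat (lhs s) m -> sat (rhs s) m.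

Lemma sat_subst (S : signature) (M : structure S) X Y (f : X -> Y)
    (phi : formula S X) (m : Y -> M) : sat (subst f phi) m <-> sat phi (m \o f).
Proof.
elim: phi Y f m => //= {X}.
- by move=> X phi IH psi IH' Y f m; rewrite IH IH'.
- by move=> X phi IH psi IH' Y f m; rewrite IH IH'.
- move=> X phi IH Y f m; have E a : oapp m a \o omap f = oapp (m \o f) a.
    by apply: funext => -[].
  by split=> -[a]; [rewrite IH E|rewrite -E -IH]; exists a.
Qed.

Lemma soundness (S : signature) (T : theory S) (M : structure S) (X : finType)
    (phi psi : formula S X) :
  models T M -> proves T phi psi -> forall m : X -> M, sat phi m -> sat psi m.
Proof.
move=> MT; elim=> {X phi psi} /=.
- by move=> s /MT.
- by [].
- by move=> X phi psi chi _ IH _ IH' m /IH/IH'.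
- by move=> X Y f phi psi _ IH m; rewrite !sat_subst; exact: IH.
- by [].
- move=> X x y phi m [xy]; rewrite !sat_subst.
  suff -> : m \o oapp id x = m \o oapp id y by [].
  by apply: funext => -[].
- by [].
- by move=> X phi psi m [].
- by move=> X phi psi m [].
- by move=> X phi psi chi _ IH _ IH' m p; split; [exact: IH|exact: IH'].
- by [].
- by left.
- by right.
- by move=> X phi psi chi _ IH _ IH' m [/IH|/IH'].
- by move=> X phi psi chi m [p [q|r]]; [left|right].
- by move=> X phi psi _ IH m [a /IH]; rewrite sat_subst.
- move=> X phi psi _ IH m p; rewrite sat_subst; apply: IH.
  by exists (m None); suff <- : m = oapp (m \o Some) (m None) by []; apply: funext => -[].
- by move=> X phi psi m [p [a q]]; exists a; rewrite sat_subst.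
Qed.

Record structure_hom (S : signature) (M N : structure S) := StructureHom {
  sh_fun :> M -> N;
  sh_interp : forall (r : S) (v : 'I_(arity r) -> M),
    interp v -> interp (sh_fun \o v)
}.

Lemma structure_hom_ext (S : signature) (M N : structure S)
  (f g : structure_hom M N) : f =1 g -> f = g.
Proof.
case: f g => [f f1] [g g1] /= /funext fg.
by subst g; congr StructureHom; exact: Prop_irrelevance.
Qed.

Definition sh_id (S : signature) (M : structure S) : structure_hom M M :=
  @StructureHom S M M id (fun r v h => h).

Definition sh_comp (S : signature) (M N P : structure S)
    (g : structure_hom N P) (f : structure_hom M N) : structure_hom M P :=
  @StructureHom S M P (g \o f) (fun r v h => sh_interp g (sh_interp f h)).

(* By [soundness], membership of a class does not depend on the chosen
   representative (see [tpP]). *)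
Definition tp (S : signature) (T : theory S) (M : structure S) (X : finType)
    (m : X -> M) : set (doctrine T X) :=
  [set class T phi | phi in [set phi : formula S X | sat phi m]].

Arguments tp {S} T {M X} m.

Lemma tpP (S : signature) (T : theory S) (M : structure S) (X : finType)
    (m : X -> M) (phi : formula S X) :
  models T M -> tp T m (class T phi) <-> sat phi m.
Proof.
move=> MT; split=> [[psi psim /class_eq[pq _]]|]; last by exists phi.
exact: soundness pq _ psim.
Qed.

Definition pair_env (X Y M : Type) (m : X -> M) (n : Y -> M) (z : X + Y) : M :=
  match z with inl x => m x | inr y => n y end.

Section Saturation.
Variables (S : signature) (M : structure S).

(* Closure under the empty conjunction matters: for tau = set0 and M empty it
   prevents tau from being vacuously consistent. *)
Definition conj_closed (X : Type) (tau : set (formula S X)) : Prop :=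
  tau Top /\ forall phi psi, tau phi -> tau psi -> tau (And phi psi).

Definition consistent (X Y : finType) (tau : set (formula S (X + Y)))
    (m : X -> M) : Prop :=
  forall phi, tau phi -> exists n : Y -> M, sat phi (pair_env m n).

Definition realised (X Y : finType) (tau : set (formula S (X + Y)))
    (m : X -> M) : Prop :=
  exists n : Y -> M, forall phi, tau phi -> sat phi (pair_env m n).

Definition omega_saturated : Prop :=
  forall (X Y : finType) (tau : set (formula S (X + Y))) (m : X -> M),
    conj_closed tau -> consistent tau m -> realised tau m.

End Saturation.

Record sat_model (S : signature) (T : theory S) := SatModel {
  sm_structure :> structure S;
  sm_models : models T sm_structure;
  sm_countable : countable [set: sm_structure];
  sm_saturated : omega_saturated sm_structure
}.

Definition omegaSat (S : signature) (T : theory S) : category.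
Proof.
apply: (@Category (sat_model T) (fun M N => structure_hom M N)
  (fun M => sh_id M) (fun M N P => @sh_comp S M N P)).
- by move=> *; apply: structure_hom_ext.
- by move=> *; apply: structure_hom_ext.
- by move=> *; apply: structure_hom_ext.
Defined.

Definition forgetful (S : signature) (T : theory S) :
    functor (omegaSat T) SET :=
  @Functor (omegaSat T) SET (fun M => M : Type)
    (fun M N f => sh_fun f) (fun=> erefl) (fun _ _ _ _ _ => erefl).

Definition prime_types_realised (S : signature) (T : theory S) : Prop :=
  forall (X : finType) (P : set (doctrine T X)), prime_filter P ->
    exists (M : sat_model T) (m : X -> M), P = tp T m.

(* Main.v *)
(* Both sides are equivalent to an isomorphism, natural in X, between the posets
   of prime types of T and T' in the variables X.  For the canonical extensions
   this holds because the principal up-sets are exactly the completely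
   join-prime elements.  Such an isomorphism turns a saturated model of T into a
   structure on the same set, in which m satisfies phi when phi lies in the
   image of tp(m); saturation is what makes this agree with satisfaction through
   existential quantifiers.  Conversely, an inclusion tp(m) <= tp(n) between
   types realised in countable saturated models is the same as a homomorphism
   sending m to n, so an equivalence over Set induces a map on types. *)
From mathcomp Require Import all_boot all_order.
From mathcomp Require Import boolp classical_sets cardinality.
Require Import Defs.

Set Implicit Arguments.
Unset Strict Implicit.
Unset Printing Implicit Defensive.

Import Order.Theory.
Local Open Scope classical_set_scope.

(** * Prime types as filters of formulae *)

Section Types.
Variables (S : signature) (T : theory S).

Lemma filter_proves (X : finType) (P : set (doctrine T X)) (phi psi : formula S X) :
  lat_filter P -> proves T phi psi -> P (class T phi) -> P (class T psi).
Proof. by move=> [_ Pu _] /class_le pq Pp; exact: Pu Pp pq. Qed.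

Lemma filter_and (X : finType) (P : set (doctrine T X)) (phi psi : formula S X) :
  lat_filter P -> P (class T (And phi psi)) <-> P (class T phi) /\ P (class T psi).
Proof.
move=> Pf; split=> [Ppq|[Pp Pq]].
  by split; apply: filter_proves Ppq => //; [exact: pr_andl|exact: pr_andr].
by rewrite class_and; case: Pf => _ _; apply.
Qed.

Lemma prime_or (X : finType) (P : set (doctrine T X)) (phi psi : formula S X) :
  prime_filter P -> P (class T (Or phi psi)) <-> P (class T phi) \/ P (class T psi).
Proof.
move=> [Pf _ Pj]; split=> [|[]].
- by rewrite class_or => /Pj.
- by apply: filter_proves => //; exact: pr_orl.
- by apply: filter_proves => //; exact: pr_orr.
Qed.

Lemma preim_class (X Y : finType) (f : X -> Y) (P : set (doctrine T Y)) phi :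
  (doctrine_map T f @^-1` P) (class T phi) = P (class T (subst f phi)).
Proof. by rewrite /= doctrine_fun_class. Qed.

(** A correspondence of types respects only inclusions and substitutions; this puts equality in
    those terms. One direction is Leibniz's rule; for the other, the substitution turns [Eq S x y]
    into [Eq S x x]. *)
Lemma eq_in_filter (X : finType) (x y : X) (P : set (doctrine T X)) :
  lat_filter P ->
  P (class T (Eq S x y)) <->
  doctrine_map T (fun z => if z == y then x else z) @^-1` P `<=` P.
Proof.
move=> Pf; split=> [Pxy a|].
  rewrite -[a]classK preim_class => Pa.
  (* The variable [None] marks the occurrences of [y]. *)
  pose psi := subst (fun z => if z == y then None else Some z) (repr a).
  have -> : repr a = subst (oapp id y) psi.
    rewrite subst_comp -[LHS]subst_id; congr subst; apply: funext => z /=.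
    by case: eqP => [->|].
  apply: (filter_proves Pf (pr_leibniz T x y psi)).
  apply/(filter_and _ _ Pf); split=> //; move: Pa.
  rewrite subst_comp; congr (P (class T (subst _ _))).
  by apply: funext => z /=; case: eqP.
apply; rewrite preim_class /= eqxx.
have -> : (if x == y then x else x) = x by case: ifP.
apply: filter_proves (pr_refl T x) _ => //.
by case: Pf.
Qed.

(** Primality of [P] makes the elements below images of non-members of [P] an ideal; the last
    hypothesis says that [F] is disjoint from it. *)
Lemma prime_filter_extension (X Z : finType) (f : X -> Z) (P : set (doctrine T X))
    (F : set (doctrine T Z)) :
  prime_filter P -> lat_filter F ->
  (forall phi chi, F (class T phi) -> proves T phi (subst f chi) -> P (class T chi)) ->
  exists Q : set (doctrine T Z),
    [/\ prime_filter Q, F `<=` Q & doctrine_map T f @^-1` Q `<=` P].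
Proof.
move=> [[Pt Pu Pm] P0 Pj] Ff FP.
pose I : set (doctrine T Z) := [set b | exists2 a, ~ P a & (b <= doctrine_map T f a)%O].
have [||Q [Qp FQ QI]] := @prime_filter_separation _ F I Ff.
- split.
  + by exists \bot%O => //; exact: le0x.
  + by move=> a b [c Pc bc] ab; exists c => //; exact: le_trans bc.
  + move=> a b [c Pc ac] [d Pd bd]; exists (c `|` d)%O; first by move=> /Pj[].
    by rewrite dl_join leU2.
- rewrite -subset0 => b [Fb [a Pa]].
  rewrite -[b]classK -[a]classK /= doctrine_fun_class => /class_le ba.
  by apply: Pa; rewrite -[a]classK; apply: FP ba; rewrite classK.
exists Q; split=> // a Qa; apply: contrapT => Pa.
suff : (Q `&` I) (doctrine_map T f a) by rewrite QI.
by split=> //; exists a.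
Qed.

End Types.

(** * Realising filters in saturated models *)

Section Realisation.
Variable S : signature.

(* An existential quantification along the injection [f]. *)
Lemma ex_along (T : theory S) (n : nat) (X Z : finType) (f : X -> Z) (phi : formula S Z) :
  injective f -> #|Z| = n + #|X| ->
  exists2 psi : formula S X, proves T phi (subst f psi) &
    forall (M : structure S) (m : X -> M), sat psi m ->
      exists2 k : Z -> M, k \o f = m & sat phi k.
Proof.
(* Induction on the number [n] of variables of [Z] outside the image of [f]. *)
move=> + ZX; elim: n => [|n IH] in X f ZX *; move=> f_inj.
  have [|g fK gK] := inj_card_bij f_inj; first by rewrite ZX.
  exists (subst g phi).
    rewrite subst_comp; have -> : f \o g = id by apply: funext => z /=.
    by rewrite subst_id; exact: pr_id.
  move=> M m /sat_subst mg; exists (m \o g) => //.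
  by apply: funext => x /=; rewrite fK.
have [z zf] : exists z, z \notin codom f.
  apply/existsP; rewrite -negb_forall; apply/negP => /forallP fs.
  have : #|Z| <= #|X|.
    by rewrite -(card_codom f_inj); apply/subset_leq_card/fintype.subsetP => z _; exact: fs.
  by rewrite ZX addSn leqNgt ltnS leq_addl.
(* Sending [None] to a variable missed by [f] leaves one variable fewer to quantify. *)
have g_inj : injective (oapp f z).
  move=> [x|] [y|] //= => [/f_inj->//|fz|zE].
    by rewrite -fz codom_f in zf.
  by rewrite zE codom_f in zf.
have [|psi phipsi psiM] := IH (option X : finType) (oapp f z) _ g_inj.
  by rewrite card_option addnS.
exists (Ex psi).
  apply: pr_cut phipsi _.
  have := pr_subst (oapp f z : (option X : finType) -> Z) (pr_ex_inv (pr_id T (Ex psi))).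
  by rewrite (subst_comp _ Some).
move=> M m [a /psiM[k kE kphi]]; exists k => //.
by apply: funext => x; have /(congr1 (@^~ (Some x))) := kE.
Qed.

Variable T : theory S.

Lemma tp_prime (M : structure S) (X : finType) (m : X -> M) :
  models T M -> prime_filter (tp T m).
Proof.
move=> MT; have E a : tp T m a <-> sat (repr a) m by rewrite -{1}[a]classK tpP.
split; [split|..].
- exact/(tpP m Top MT).
- by move=> a b /E am /le_repr ab; apply/E; exact: soundness ab _ am.
- by move=> a b /E am /E bm; rewrite -[a]classK -[b]classK -class_and; apply/tpP.
- by move=> /(tpP m Bot MT).
- move=> a b; rewrite -[a]classK -[b]classK -class_or.
  by move=> /(tpP _ _ MT)[] ?; [left|right]; apply/(tpP _ _ MT).
Qed.

Lemma tp_comp (M : structure S) (X Y : finType) (f : X -> Y) (m : Y -> M) :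
  models T M -> doctrine_map T f @^-1` tp T m = tp T (m \o f).
Proof.
move=> MT; apply/seteqP; split=> a; rewrite -[a]classK preim_class.
  by rewrite !(tpP _ _ MT) sat_subst.
by rewrite !(tpP _ _ MT) sat_subst.
Qed.

(** Saturation is applied to the pullback of [Q] along [g], which identifies the parameter [x] with
    the variable [f x]. Quantifying out [Z] leaves a formula about [m] alone, so the inclusion in
    [tp T m] gives consistency. *)
Lemma realise_filter (M : structure S) (X Z : finType) (f : X -> Z)
    (Q : set (doctrine T Z)) (m : X -> M) :
  models T M -> omega_saturated M -> lat_filter Q ->
  doctrine_map T f @^-1` Q `<=` tp T m ->
  exists2 n : Z -> M, n \o f = m & Q `<=` tp T n.
Proof.
move=> MT Msat Qf Qm.
pose g (z : X + Z) : Z := match z with inl x => f x | inr z => z end.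
pose tau : set (formula S (X + Z)) := [set phi | Q (class T (subst g phi))].
have [||n nt] := Msat X Z tau m.
- by split=> [|phi psi p q]; [case: Qf|exact/(filter_and _ _ Qf)].
- move=> phi tphi.
  have [||psi phipsi psiM] := @ex_along T #|Z| _ _ (@inl X Z) phi.
  + by move=> x y [].
  + by rewrite card_sum addnC.
  have /(tpP _ _ MT)/psiM[k kE kphi] : tp T m (class T psi).
    apply: Qm; rewrite preim_class.
    apply: filter_proves tphi => //.
    by have := pr_subst g phipsi; rewrite (subst_comp _ inl).
  exists (k \o inr); suff -> : pair_env m (k \o inr) = k by [].
  by apply: funext => -[x|//] /=; rewrite -kE.
exists n.
  (* The type equates [f x] with the parameter [x], since [g] turns this equation into
     reflexivity. *)
  apply: funext => x; have /= -> // := nt (Eq S (inr (f x)) (inl x)).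
  rewrite /tau /=; apply: filter_proves (pr_refl T (f x)) _ => //.
  by case: Qf.
move=> a; rewrite -[a]classK => Qa; apply/(tpP _ _ MT).
have /nt/sat_subst // : tau (subst inr (repr a)).
by rewrite /tau /= subst_comp subst_id.
Qed.

End Realisation.

Lemma sat_hom (S : signature) (M N : structure S) (h : structure_hom M N) X
    (phi : formula S X) (m : X -> M) : sat phi m -> sat phi (h \o m).
Proof.
elim: phi m => //= {X}.
- by move=> X r v m /(sh_interp h).
- by move=> X x y m ->.
- by move=> X phi IH psi IH' m [/IH + /IH'].
- by move=> X phi IH psi IH' m [/IH|/IH']; [left|right].
- move=> X phi IH m [a /IH ha]; exists (h a); congr (sat phi _): ha.
  by apply: funext => -[].
Qed.

Lemma tp_hom (S : signature) (T : theory S) (M N : structure S)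
    (h : structure_hom M N) (X : finType) (m : X -> M) :
  tp T m `<=` tp T (h \o m).
Proof. by move=> _ [phi /(sat_hom h) hphi <-]; exists phi. Qed.

(** * Homomorphisms from inclusions of types *)

Section Homogeneity.
Variables (S : signature) (T : theory S) (M N : structure S).
Hypotheses (MT : models T M) (NT : models T N).
Hypotheses (Mcount : countable [set: M]) (Nsat : omega_saturated N).

Let partial_hom := {X : finType & X -> M * N}.
Let type_preserving (v : partial_hom) :=
  tp T (fst \o tagged v) `<=` tp T (snd \o tagged v).

(** The type of the source tuple with [a] adjoined restricts to that of the tuple, hence can be
    realised over the images already chosen. *)
Lemma partial_hom_extend (v : partial_hom) (a : M) : type_preserving v ->
  exists2 w, type_preserving w &
    range (tagged v) `<=` range (tagged w) /\ exists b, range (tagged w) (a, b).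
Proof.
case: v => X v vP.
have [||n nE tpn] := @realise_filter _ T N X (option X : finType) Some
    (tp T (oapp (fst \o v) a : (option X : finType) -> M)) (snd \o v) NT Nsat.
- by case: (tp_prime (oapp (fst \o v) a : (option X : finType) -> M) MT).
- by rewrite (tp_comp _ _ MT).
pose w (z : option X) := (oapp (fst \o v) a z, n z).
exists (@Tagged finType (option X) (fun X => X -> M * N) w) => //; split.
  move=> _ [x _ <-]; exists (Some x) => //=.
  by rewrite /w -[n _]/((n \o Some) x) nE /=; case: (v x).
by exists (n None), None.
Qed.

(* Only the target is saturated, so one goes forth but not back: the
   countably many elements of the source are given images one after the other. *)
Lemma hom_extend (X : finType) (m : X -> M) (n : X -> N) :
  tp T m `<=` tp T n -> exists h : structure_hom M N, h \o m = n.
Proof.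
move=> mn.
have [e e_inj] : exists e : M -> nat, injective e.
  have /countable_injP[e /in2TT e_inj] := Mcount; exists e.
  exact: e_inj.
pose st := {v : partial_hom | type_preserving v}.
(* The step numbered [k] adds the element [a] with [e a = k], if there is one, to the domain. *)
have /choice[step stepP] : forall p : st * nat, exists q : st,
    range (tagged (sval p.1)) `<=` range (tagged (sval q)) /\
    forall a, e a = p.2 -> exists b, range (tagged (sval q)) (a, b).
  move=> [[v vP] k] /=.
  have [[a ak]|na] := pselect (exists a, e a = k); last first.
    by exists (exist _ v vP); split=> // a ak; case: na; exists a.
  have [w wP [vw wa]] := partial_hom_extend a vP.
  exists (exist _ w wP); split=> // a'; rewrite -ak => /e_inj->; exact: wa.
pose v0 : st := exist type_preserving
  (@Tagged finType X (fun X => X -> M * N) (fun x => (m x, n x))) mn.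
pose v := fix v k : st := if k is k'.+1 then step (v k', k') else v0.
pose A k := range (tagged (sval (v k))).
have A_mono k k' : k <= k' -> A k `<=` A k'.
  elim: k' => [|k' IH]; first by rewrite leqn0 => /eqP->.
  rewrite leq_eqVlt => /orP[/eqP->//|/IH kk'].
  by apply: subset_trans kk' _; have [] := stepP (v k', k').
(* A tuple of pairs present at stage [k] is a reindexing of that stage, so formulae pass from its
   sources to its images. *)
have A_tp k (Y : finType) (u : Y -> M * N) : range u `<=` A k ->
    forall phi : formula S Y, sat phi (fst \o u) -> sat phi (snd \o u).
  move=> uA phi.
  have /choice[g gE] : forall y, exists x, tagged (sval (v k)) x = u y.
    by move=> y; have [|x _ <-] := uA (u y); [exists y|exists x].
  have -> : u = tagged (sval (v k)) \o g by apply: funext => y /=.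
  rewrite -[fst \o _]/((fst \o tagged (sval (v k))) \o g).
  rewrite -[snd \o _]/((snd \o tagged (sval (v k))) \o g).
  move=> /sat_subst/(tpP _ _ MT)/(svalP (v k))/(tpP _ _ NT) vphi.
  exact/sat_subst.
have /choice[h hP] : forall a, exists b, A (e a).+1 (a, b).
  by move=> a; have [_] := stepP (v (e a), e a); apply.
have A_fun k k' a b b' : A k (a, b) -> A k' (a, b') -> b = b'.
  move=> /(A_mono _ _ (leq_maxl k k')) ab /(A_mono _ _ (leq_maxr k k')) ab'.
  (* Equality of the two variables holds of [(a, a)], hence of [(b, b')]. *)
  pose u i := (a, if i then b else b').
  have uA : range u `<=` A (maxn k k') by move=> _ [[] _ <-].
  exact: (A_tp _ bool u uA (Eq S true false) erefl).
have h_interp (r : S) (u : 'I_(arity r) -> M) : interp u -> interp (h \o u).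
  (* By stage [k] all coordinates of [u] have entered the domain. *)
  move=> ru; pose k := \max_i (e (u i)).+1.
  have uA : range (fun i => (u i, h (u i))) `<=` A k.
    by move=> _ [i _ <-]; apply: A_mono (hP (u i)); exact: (leq_bigmax i).
  exact: (A_tp _ _ _ uA (Rel id) ru).
exists (StructureHom h_interp); apply: funext => x /=.
by apply: (A_fun _ 0) (hP _) _; exists x.
Qed.

End Homogeneity.

(** * Correspondences of prime types and canonical extensions *)

(* A natural isomorphism between the posets of prime types, presented as a
   relation so that exchanging the two theories is a mere flip. *)
Record type_correspondence (S S' : signature) (T : theory S) (T' : theory S')
    (R : forall X : finType, set (doctrine T X) -> set (doctrine T' X) -> Prop) :
    Prop := TypeCorrespondence {
  tc_prime : forall (X : finType) (P : set (doctrine T X)) P',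
    R X P P' -> prime_filter P /\ prime_filter P';
  tc_totall : forall (X : finType) (P : set (doctrine T X)),
    prime_filter P -> exists P', R X P P';
  tc_totalr : forall (X : finType) (P' : set (doctrine T' X)),
    prime_filter P' -> exists P, R X P P';
  tc_mono : forall (X : finType) (P Q : set (doctrine T X)) P' Q',
    R X P P' -> R X Q Q' -> P `<=` Q <-> P' `<=` Q';
  tc_nat : forall (X Y : finType) (f : X -> Y) (P : set (doctrine T Y)) P',
    R Y P P' -> R X (doctrine_map T f @^-1` P) (doctrine_map T' f @^-1` P')
}.

Lemma type_correspondence_flip (S S' : signature) (T : theory S) (T' : theory S')
    (R : forall X : finType, set (doctrine T X) -> set (doctrine T' X) -> Prop) :
  type_correspondence R -> type_correspondence (fun X P' P => R X P P').
Proof.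
case=> prime totl totr mono nat; split=> //.
- by move=> X P P' /prime[].
- by move=> X P Q P' Q' PP' QQ'; have [] := mono X _ _ _ _ PP' QQ'; split.
- by move=> X Y f P P'; exact: nat.
Qed.

Section CanonicalExtensionIso.
Variables (S S' : signature) (T : theory S) (T' : theory S').

Definition principal_upset (L : tbDistrLatticeType lat_display) (P : set L) :
  canext L := up_meet (@up_emb L @` P).

Lemma principal_upsetP (L : tbDistrLatticeType lat_display) (P Q : set L) :
  prime_filter Q -> up_set (principal_upset P) Q <-> P `<=` Q.
Proof.
move=> Qp; split=> [[_ PQ] a Pa|PQ]; last first.
  by split=> // _ [a /PQ Qa <-]; split.
by have [|] := PQ (up_emb a); first by exists a.
Qed.

(** Turns membership into an order relation, which isomorphisms of complete lattices preserve. *)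
Lemma principal_upset_le (L : tbDistrLatticeType lat_display) (P : set L)
    (U : canext L) :
  prime_filter P -> (principal_upset P <= U)%O <-> up_set U P.
Proof.
move=> Pp; split=> [/up_leP|UP]; first by apply; exact/principal_upsetP.
apply/up_leP => Q PQ; have Qp := up_prime PQ.
by apply: up_closed UP => //; exact/(principal_upsetP _ Qp).
Qed.

Lemma complete_hom_le (C D : complat) (h : complete_hom C D) (u v : C) :
  (u <= v)%O -> (h u <= h v)%O.
Proof.
move=> uv; have [|+ _] := @ch_sup _ _ h [set u; v] v.
  by split=> [_ [->|->]//|w]; apply; right.
by apply; exists u => //; left.
Qed.

Lemma complete_hom_cancel_le (C D : complat) (h : complete_hom C D)
    (g : complete_hom D C) (u v : C) :
  cancel h g -> (u <= v)%O <-> (h u <= h v)%O.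
Proof.
move=> hK; split; first exact: complete_hom_le.
by move=> /(complete_hom_le g); rewrite !hK.
Qed.

(* Principal up-sets are completely join-prime. *)
Lemma principal_upset_iso (L K : tbDistrLatticeType lat_display)
    (h : complete_hom (canext L) (canext K))
    (g : complete_hom (canext K) (canext L)) (P : set L) :
  cancel h g -> cancel g h -> prime_filter P ->
  exists2 P', prime_filter P' & h (principal_upset P) = principal_upset P'.
Proof.
move=> hK gK Pp; set W := h _.
pose V : set (canext K) := [set U | exists2 P', up_set W P' & U = principal_upset P'].
have VW : supremums V W.
  split=> [_ [P' WP' ->]|U UV].
    by apply/principal_upset_le => //; exact: up_prime WP'.
  apply/up_leP => P' WP'; apply/principal_upset_le; first exact: up_prime WP'.
  by apply: UV; exists P'.
have /up_joinP/(congr1 (@up_set _)) := ch_sup g VW; rewrite hK => E.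
(* Joins of up-sets are unions, so [P] lies in the image under [g] of a single principal up-set
   below [W], which is then all of [W]. *)
have [_ [U [P' WP' UE] <-] gUP] : up_set (up_join (g @` V)) P.
  by rewrite -E; apply/principal_upsetP.
have P'p := up_prime WP'; exists P' => //; apply/le_anti/andP; split.
  by rewrite -UE -[U]gK; apply/complete_hom_le/principal_upset_le.
exact/principal_upset_le.
Qed.

Lemma correspondence_of_delta_iso :
  naturally_isomorphic (doctrine_delta T) (doctrine_delta T') ->
  exists R, @type_correspondence _ _ T T' R.
Proof.
move=> [h [g [h_nat gh hg]]].
have hK (X : finType) : cancel (h X) (g X).
  by move=> U; have /(congr1 (@ch_fun _ _))/(congr1 (@^~ U)) := gh X.
have gK (X : finType) : cancel (g X) (h X).
  by move=> U; have /(congr1 (@ch_fun _ _))/(congr1 (@^~ U)) := hg X.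
pose R (X : finType) (P : set (doctrine T X)) (P' : set (doctrine T' X)) :=
  [/\ prime_filter P, prime_filter P' &
      h X (principal_upset P) = principal_upset P'].
have mono (X : finType) (P Q : set (doctrine T X)) P' Q' :
    R X P P' -> R X Q Q' -> P `<=` Q <-> P' `<=` Q'.
  move=> [Pp P'p hP] [Qp Q'p hQ].
  rewrite -(principal_upsetP _ Qp) -(principal_upset_le _ Qp).
  rewrite -(principal_upsetP _ Q'p) -(principal_upset_le _ Q'p) -hP -hQ.
  exact: complete_hom_cancel_le (hK X).
have totl (X : finType) (P : set (doctrine T X)) :
    prime_filter P -> exists P', R X P P'.
  by move=> Pp; have [P'] := principal_upset_iso (hK X) (gK X) Pp; exists P'.
have totr (X : finType) (P' : set (doctrine T' X)) :
    prime_filter P' -> exists P, R X P P'.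
  move=> P'p; have [P Pp gP] := principal_upset_iso (gK X) (hK X) P'p; exists P.
  by split=> //; rewrite -gP; exact: gK.
exists R; split=> //; first by move=> X P P' [].
move=> X Y f P P' RP; have [Pp P'p hP] := RP.
have fPp := prime_filter_preimage (doctrine_map T f) Pp.
have fP'p := prime_filter_preimage (doctrine_map T' f) P'p.
(* A type lies below the restriction of [P] iff [P] belongs to the image under [f] of its principal
   up-set; naturality of [h] carries this condition over to [P']. *)
have sub (V : set (doctrine T X)) (W : set (doctrine T' X)) :
    R X V W -> V `<=` doctrine_map T f @^-1` P <-> W `<=` doctrine_map T' f @^-1` P'.
  move=> [Vp Wp hV].
  rewrite -(principal_upsetP _ fPp) -(principal_upsetP _ fP'p) -hV.
  have E : h Y (canext_fun (doctrine_map T f) (principal_upset V)) =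
           canext_fun (doctrine_map T' f) (h X (principal_upset V)).
    by have /(congr1 (@ch_fun _ _))/(congr1 (@^~ (principal_upset V))) := h_nat X Y f.
  have -> : up_set (principal_upset V) (doctrine_map T f @^-1` P) <->
      (principal_upset P <= canext_fun (doctrine_map T f) (principal_upset V))%O.
    by rewrite principal_upset_le //; split=> [|[]].
  have -> : up_set (h X (principal_upset V)) (doctrine_map T' f @^-1` P') <->
      (principal_upset P' <= canext_fun (doctrine_map T' f) (h X (principal_upset V)))%O.
    by rewrite principal_upset_le //; split=> [|[]].
  rewrite -E -hP; exact: complete_hom_cancel_le (hK Y).
(* As in the Yoneda lemma, testing [sub] on the two restrictions and their partners gives both
   inclusions. *)
have [W RW] := totl _ _ fPp; have [V RV] := totr _ _ fP'p.
have E : V = doctrine_map T f @^-1` P.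
  apply/seteqP; split; first exact/(sub _ _ RV).
  by apply/(mono _ _ _ _ _ RW RV)/(sub _ _ RW).
by rewrite -E.
Qed.

Variable R : forall X : finType, set (doctrine T X) -> set (doctrine T' X) -> Prop.

Section Transport.
Hypothesis Rc : type_correspondence R.

#[local] Obligation Tactic := idtac.

Program Definition transport_upset (X : finType) (U : canext (doctrine T X)) :
    canext (doctrine T' X) :=
  @UpSet _ [set P' | exists2 P, R P P' & up_set U P] _ _.
Next Obligation. by move=> X U P' [P /(tc_prime Rc)[]]. Qed.
Next Obligation.
move=> X U P' Q' Q'p PQ' [P RP UP]; have [Q RQ] := tc_totalr Rc Q'p.
exists Q => //; apply: up_closed UP; first by have [] := tc_prime Rc RQ.
exact/(tc_mono Rc RP RQ).
Qed.

Lemma tc_funl (X : finType) (P Q : set (doctrine T X)) P' :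
  R P P' -> R Q P' -> P = Q.
Proof.
move=> RP RQ; apply/seteqP; split.
  exact/(tc_mono Rc RP RQ).
exact/(tc_mono Rc RQ RP).
Qed.

Lemma tc_funr (X : finType) (P : set (doctrine T X)) P' Q' :
  R P P' -> R P Q' -> P' = Q'.
Proof.
move=> RP RQ; apply/seteqP; split.
  exact/(tc_mono Rc RP RQ).
exact/(tc_mono Rc RQ RP).
Qed.

Fact transport_upset_sup (X : finType) A u :
  supremums A u -> supremums (@transport_upset X @` A) (transport_upset u).
Proof.
move=> /up_joinP->; apply/up_joinP/upset_inj/seteqP; split=> P'.
  by move=> [P RP [U AU UP]]; exists (transport_upset U); [exists U|exists P].
by move=> [_ [U AU <-] [P RP UP]]; exists P => //; exists U.
Qed.

Fact transport_upset_inf (X : finType) A u :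
  infimums A u -> infimums (@transport_upset X @` A) (transport_upset u).
Proof.
move=> /up_meetP->; apply/up_meetP/upset_inj/seteqP; split=> P'.
  move=> [P RP [Pp AP]]; split; first by have [] := tc_prime Rc RP.
  by move=> _ [U AU <-]; exists P => //; exact: AP.
move=> [P'p AP']; have [P RP] := tc_totalr Rc P'p; exists P => //.
split; first by have [] := tc_prime Rc RP.
move=> U AU; have [|Q RQ UQ] := AP' (transport_upset U); first by exists U.
by rewrite (tc_funl RP RQ).
Qed.

Definition transport (X : finType) :
  complete_hom (canext (doctrine T X)) (canext (doctrine T' X)) :=
  CompleteHom (@transport_upset_sup X) (@transport_upset_inf X).

End Transport.

End CanonicalExtensionIso.

(** Direct images of up-sets along the relation, in its two directions, are mutually inverse. *)
Lemma delta_iso_of_correspondence (S S' : signature) (T : theory S) (T' : theory S')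
    (R : forall X : finType, set (doctrine T X) -> set (doctrine T' X) -> Prop) :
  type_correspondence R ->
  naturally_isomorphic (doctrine_delta T) (doctrine_delta T').
Proof.
move=> Rc; have Rc' := type_correspondence_flip Rc.
exists (transport Rc), (transport Rc'); split.
- move=> X Y f; apply: complete_hom_ext => U; apply/upset_inj/seteqP; split=> P' /=.
    move=> [P RP [_ UP]]; split; first by have [] := tc_prime Rc RP.
    by exists (doctrine_map T f @^-1` P) => //; exact: tc_nat.
  move=> [P'p [Q RQ UQ]]; have [P RP] := tc_totalr Rc P'p; exists P => //.
  split; first by have [] := tc_prime Rc RP.
  by rewrite (tc_funl Rc (tc_nat Rc f RP) RQ).
- move=> X; apply: complete_hom_ext => U; apply/upset_inj/seteqP; split=> P /=.
    by move=> [P' RP' [Q RQ UQ]]; rewrite (tc_funl Rc RP' RQ).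
  move=> UP; have [P' RP] := tc_totall Rc (up_prime UP).
  by exists P' => //; exists P.
- move=> X; apply: complete_hom_ext => U; apply/upset_inj/seteqP; split=> P' /=.
    by move=> [P RP [Q' RQ UQ]]; rewrite (tc_funr Rc RP RQ).
  move=> UP'; have [P RP] := tc_totalr Rc (up_prime UP').
  by exists P => //; exists P'.
Qed.

(** * Translating saturated models along a correspondence *)

Section Translation.
Variables (S S' : signature) (T : theory S) (T' : theory S').
Variable R : forall X : finType, set (doctrine T X) -> set (doctrine T' X) -> Prop.
Hypothesis Rc : type_correspondence R.

(** The atom [Rel id], whose variables are the argument places of [r], is tested in the type
    corresponding to that of [v]. *)
Definition translate (M : structure S) : structure S' :=
  @Structure S' M (fun r v =>
    exists2 P', R (tp T v) P' & P' (class T' (Rel (@id 'I_(arity r))))).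

Lemma tc_eq (X : finType) (x y : X) (P : set (doctrine T X)) P' :
  R P P' -> P (class T (Eq S x y)) <-> P' (class T' (Eq S' x y)).
Proof.
move=> RP; have [[Pf _ _] [P'f _ _]] := tc_prime Rc RP.
rewrite (eq_in_filter x y Pf) (eq_in_filter x y P'f).
exact: tc_mono (tc_nat Rc _ RP) RP.
Qed.

Section Model.
Variable M : structure S.
Hypotheses (MT : models T M) (Msat : omega_saturated M).

(** The induction on formulae ranges over arbitrary [X]; [g] moves the formula into a finite
    context, where types are available. Only the converse for [Ex] needs saturation. *)
Lemma sat_translate (X : Type) (phi : formula S' X) (Y : finType) (g : X -> Y)
    (m : Y -> M) (P' : set (doctrine T' Y)) :
  R (tp T m) P' ->
  sat phi (m \o g : X -> translate M) <-> P' (class T' (subst g phi)).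
Proof.
elim: phi Y g m P' => {X} [X r v|X x y|X|X|X phi IH psi IH'|X phi IH psi IH'|X phi IH]
  Y g m P' RP; have [Pp P'p] := tc_prime Rc RP; have [P'f P'0 _] := P'p.
- have := tc_nat Rc (g \o v) RP; rewrite (tp_comp _ _ MT) => Rv.
  split=> /= [[Q' RQ']|P'r].
    rewrite (tc_funr Rc RQ' Rv) preim_class //.
  by exists (doctrine_map T' (g \o v) @^-1` P') => //; rewrite preim_class.
- by rewrite /= -(tc_eq _ _ RP) (tpP _ _ MT).
- by split=> // _; case: P'f.
- by split=> //= /P'0.
- have IHm := IH _ _ _ _ RP; have IHm' := IH' _ _ _ _ RP.
  split=> [[/IHm p /IHm' q]|/(filter_and _ _ P'f)[/IHm p /IHm' q]] //.
  exact/(filter_and _ _ P'f).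
- have IHm := IH _ _ _ _ RP; have IHm' := IH' _ _ _ _ RP.
  split=> [[/IHm p|/IHm' q]|/(prime_or _ _ P'p)[/IHm p|/IHm' q]].
  + by apply/(prime_or _ _ P'p); left.
  + by apply/(prime_or _ _ P'p); right.
  + by left.
  + by right.
- split=> [[a phia]|P'phi].
    pose ma : (option Y : finType) -> M := oapp m a.
    have [Q' RQ] := tc_totall Rc (tp_prime ma MT).
    have Q'phi : Q' (class T' (subst (omap g) phi)).
      apply/(IH _ _ _ _ RQ); congr (sat phi _): phia.
      by apply: funext => -[].
    have := tc_nat Rc (Some : Y -> (option Y : finType)) RQ.
    rewrite (tp_comp _ _ MT) => /(tc_funr Rc RP) ->; rewrite preim_class /=.
    have [_ [Q'f _ _]] := tc_prime Rc RQ; apply: filter_proves Q'phi => //.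
    exact: pr_ex_inv (pr_id _ _).
  (* A witness is first adjoined for [T']: the body of the quantifier generates a filter that
     extends to a prime type restricting below [P']. Its partner is then realised in [M] over
     [m]. *)
  pose F : set (doctrine T' (option Y : finType)) :=
    [set b | (class T' (subst (omap g) phi) <= b)%O].
  have [|chi psi phichi chipsi|Q' [Q'p FQ Q'P]] :=
    @prime_filter_extension _ T' Y (option Y : finType) Some P' F P'p.
  + exact: principal_filter.
  + apply: filter_proves P'phi => //; apply: pr_ex.
    by apply: pr_cut chipsi; exact/class_le.
  have [Q RQ] := tc_totalr Rc Q'p; have [Qp _] := tc_prime Rc RQ.
  have [||n nm Qn] := @realise_filter _ T M Y (option Y : finType) Some Q m MT Msat.
  + by case: Qp.
  + exact/(tc_mono Rc (tc_nat Rc _ RQ) RP).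
  exists (n None).
  (* [Q] is only contained in the type of [n]; monotonicity carries the body from [Q'] up to
     [N']. *)
  have [N' RN] := tc_totall Rc (tp_prime n MT).
  have : N' (class T' (subst (omap g) phi)).
    by apply: (tc_mono Rc RQ RN).1 => //; apply: FQ; exact: lexx.
  move=> /(IH _ _ _ _ RN); congr (sat phi _).
  by apply: funext => -[x|//] /=; rewrite -nm.
Qed.

Lemma tp_translate (X : finType) (m : X -> M) :
  R (tp T m) (tp T' (m : X -> translate M)).
Proof.
have [P' RP] := tc_totall Rc (tp_prime m MT).
suff -> : tp T' (m : X -> translate M) = P' by [].
have E phi : sat phi (m : X -> translate M) <-> P' (class T' phi).
  by rewrite -{2}[phi]subst_id -(sat_translate _ _ RP).
apply/seteqP; split=> [_ [phi /E + <-]//|a].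
by rewrite -[a]classK => /E ?; exists (repr a).
Qed.

Lemma translate_models : models T' (translate M).
Proof.
move=> s sT m.
have [_ [P'f _ _]] := tc_prime Rc (tp_translate m).
have E phi : sat phi m <-> tp T' m (class T' phi).
  by rewrite -{2}[phi]subst_id -(sat_translate _ _ (tp_translate m)).
by move=> /E lm; apply/E; apply: filter_proves lm => //; exact: pr_axiom.
Qed.

(** A consistent type extends to a prime type of [T'] restricting below the type of [m]. Saturation
    of [M] realises its partner, and monotonicity brings the realisation back. *)
Lemma translate_saturated : omega_saturated (translate M).
Proof.
move=> X Y tau m [tau0 tauI] tauC.
pose F : set (doctrine T' ((X + Y)%type : finType)) :=
  [set b | exists2 phi, tau phi & (class T' phi <= b)%O].
have M'T := translate_models.
have [|phi chi [psi tpsi psiphi] phichi|Q' [Q'p FQ Q'm]] :=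
  @prime_filter_extension _ T' X ((X + Y)%type : finType) inl _ F (tp_prime m M'T).
- split; first by exists Top => //; exact: lexx.
  + by move=> a b [phi tphi phia] ab; exists phi => //; exact: le_trans ab.
  + move=> a b [phi tphi phia] [psi tpsi psib].
    by exists (And phi psi); [exact: tauI|rewrite class_and leI2].
- have [n npsi] := tauC _ tpsi; apply/(tpP _ _ M'T).
  have psichi := pr_cut ((class_le _ _ _).1 psiphi) phichi.
  by have /sat_subst := soundness M'T psichi npsi.
have [Q RQ] := tc_totalr Rc Q'p; have [Qp _] := tc_prime Rc RQ.
have [||n nm Qn] := @realise_filter _ T M X ((X + Y)%type : finType) inl Q m MT Msat.
- by case: Qp.
- exact/(tc_mono Rc (tc_nat Rc _ RQ) (tp_translate m)).
exists (n \o inr) => phi tphi.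
have -> : pair_env m (n \o inr) = n :> (_ -> translate M).
  by apply: funext => -[x|//] /=; rewrite -nm.
apply/(tpP _ _ M'T); apply: (tc_mono Rc RQ (tp_translate n)).1 => //.
by apply: FQ; exists phi => //; exact: lexx.
Qed.

End Model.

Definition translate_model (M : sat_model T) : sat_model T' :=
  @SatModel S' T' (translate M)
    (translate_models (@sm_models _ _ M) (@sm_saturated _ _ M)) (@sm_countable _ _ M)
    (translate_saturated (@sm_models _ _ M) (@sm_saturated _ _ M)).

(** Homomorphisms enlarge types, and the correspondence is monotone. *)
Lemma translate_hom_interp (M N : sat_model T) (h : structure_hom M N) (r : S')
    (v : 'I_(arity r) -> translate M) :
  interp v -> @interp _ (translate N) r (h \o v).
Proof.
move=> [P' RP P'r].
have [Q' RQ] := tc_totall Rc (tp_prime (h \o v : _ -> N) (@sm_models _ _ N)).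
by exists Q' => //; apply: (tc_mono Rc RP RQ).1 P'r; exact: tp_hom.
Qed.

Definition translate_functor : functor (omegaSat T) (omegaSat T').
Proof.
apply: (@Functor (omegaSat T) (omegaSat T') translate_model
  (fun M N h => @StructureHom S' (translate M) (translate N) h
    (@translate_hom_interp M N h))).
- by move=> M; exact: structure_hom_ext.
- by move=> M N P g h; exact: structure_hom_ext.
Defined.

Lemma translate_functor_over : compF (forgetful T') translate_functor = forgetful T.
Proof. by congr Functor; exact: Prop_irrelevance. Qed.

End Translation.

(** Translating back and forth yields equivalent relations on the same set, so identity maps are the
    isomorphisms. *)
Lemma translateK (S S' : signature) (T : theory S) (T' : theory S')
    (R : forall X : finType, set (doctrine T X) -> set (doctrine T' X) -> Prop)
    (Rc : type_correspondence R)
    (Rc' : type_correspondence (fun X P' P => R X P P')) :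
  naturally_isomorphic (compF (translate_functor Rc') (translate_functor Rc))
    (idF (omegaSat T)).
Proof.
pose M2 (M : sat_model T) := compF (translate_functor Rc') (translate_functor Rc) M.
have E (M : sat_model T) (r : S) (v : 'I_(arity r) -> M) :
    @interp _ (M2 M) r v <-> interp v.
  have MT := @sm_models _ _ M.
  have RM := tp_translate Rc MT (@sm_saturated _ _ M) v.
  have -> : interp v <-> tp T v (class T (Rel id)) by rewrite (tpP _ _ MT).
  split=> [[P RP]|vr]; last by exists (tp T v).
  by rewrite (tc_funl Rc RP RM).
exists (fun M : sat_model T => @StructureHom _ (M2 M) M id (fun r v => (E M r v).1)).
exists (fun M : sat_model T => @StructureHom _ M (M2 M) id (fun r v => (E M r v).2)).
by split=> *; exact: structure_hom_ext.
Qed.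

Lemma equivalent_of_correspondence (S S' : signature) (T : theory S) (T' : theory S')
    (R : forall X : finType, set (doctrine T X) -> set (doctrine T' X) -> Prop) :
  type_correspondence R -> equivalent_over (forgetful T) (forgetful T').
Proof.
move=> Rc; have Rc' := type_correspondence_flip Rc.
exists (translate_functor Rc), (translate_functor Rc'); split.
- exact: translateK.
- exact: (translateK Rc' Rc).
- exact: translate_functor_over.
- exact: translate_functor_over.
Qed.

(** * Recovering a correspondence from an equivalence *)

(** As [G] is faithful, it is enough to match [k] after applying [G]; conjugating [fmap G k] by the
    isomorphism [e] does so. *)
Lemma equivalence_full (A B : category) (F : functor A B) (G : functor B A) :
  naturally_isomorphic (compF G F) (idF A) ->
  naturally_isomorphic (compF F G) (idF B) ->
  forall (a b : A) (k : hom (F a) (F b)), exists h : hom a b, fmap F h = k.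
Proof.
move=> [e [e' [e_nat e'e _]]] [d [d' [d_nat _ dd']]] a b k.
have G_faithful (k1 k2 : hom (F a) (F b)) : fmap G k1 = fmap G k2 -> k1 = k2.
  move=> k12; have E k0 : k0 = compm (d (F b)) (compm (fmap F (fmap G k0)) (d' (F a))).
    have := d_nat _ _ k0; rewrite /= compmA => ->.
    by rewrite -compmA dd' compm1.
  by rewrite [k1]E [k2]E k12.
exists (compm (e b) (compm (fmap G k) (e' a))); apply: G_faithful.
have := e_nat _ _ (compm (e b) (compm (fmap G k) (e' a))).
rewrite /= -!compmA e'e compm1 => /(congr1 (compm (e' b))).
by rewrite !compmA e'e !comp1m.
Qed.

(** A strict equality of functors is used only through these bijections, which avoids transporting
    elements along equalities of types. *)
Lemma functor_eq_bij (A : category) (P Q : functor A SET) : P = Q ->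
  exists t : forall a, P a -> Q a, (forall a, bijective (t a)) /\
    forall a b (f : hom a b) x, t b (fmap P f x) = fmap Q f (t a x).
Proof.
by move=> <-; exists (fun a => id); split=> // a; exists id.
Qed.

(* The isomorphisms G F = 1 and F G = 1 need not lie over the identity, so the
   maps of types induced by F and G need not be mutually inverse; the map
   induced by F is nevertheless an isomorphism, because F is full and
   essentially surjective. *)
Lemma correspondence_of_equivalent (S S' : signature) (T : theory S) (T' : theory S') :
  prime_types_realised T -> prime_types_realised T' ->
  equivalent_over (forgetful T) (forgetful T') ->
  exists R, @type_correspondence _ _ T T' R.
Proof.
move=> hT hT' [F [G [GF FG VF _]]].
have [t [t_bij t_nat]] := functor_eq_bij (esym VF).
have F_full := equivalence_full GF FG.
have extend U (V : theory U) (M N : sat_model V) (X : finType) (m : X -> M) (n : X -> N) :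
    tp V m `<=` tp V n -> exists h : structure_hom M N, h \o m = n.
  apply: hom_extend; [exact: sm_models|exact: sm_models| |exact: sm_saturated].
  exact: sm_countable.
(* The type of [m] in [M] is related to the type of the same tuple read in [F M]; monotonicity makes
   the choice of realisation immaterial. *)
exists (fun (X : finType) P P' => exists (M : sat_model T) (m : X -> M),
  P = tp T m /\ P' = tp T' (t M \o m : X -> (F M : sat_model T'))); split.
- by move=> X _ _ [M [m [-> ->]]]; split; apply/tp_prime/sm_models.
- by move=> X P /hT[M [m ->]]; exists (tp T' (t M \o m : X -> (F M : sat_model T'))), M, m.
- move=> X P' /hT'[N [n ->]]; have [d [d' [_ _ dd']]] := FG.
  have [s sK tK] := t_bij (G N); pose dN : structure_hom _ _ := d N.
  pose d'N : structure_hom _ _ := d' N.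
  (* Essential surjectivity: [n] is moved into [F (G N)] by [d'N] and pulled back along [t]. *)
  exists (tp T (s \o (d'N \o n) : X -> (G N : sat_model T))), (G N), (s \o (d'N \o n)).
  split=> //; have -> : t (G N) \o (s \o (d'N \o n)) = d'N \o n.
    by apply: funext => x /=; rewrite tK.
  (* Both [d'N] and its inverse [dN] enlarge types, so the type is unchanged. *)
  apply/seteqP; split; first exact: tp_hom.
  have {2}-> : n = dN \o (d'N \o n).
    by apply: funext => x; have /(congr1 (@^~ (n x) \o @sh_fun _ _ _)) := dd' N.
  exact: tp_hom.
- move=> X _ _ _ _ [M [m [-> ->]]] [N [n [-> ->]]]; split=> [/extend[h hm]|].
    suff -> : t N \o n = (fmap F (h : hom (M : omegaSat T) N) : structure_hom _ _) \o (t M \o m).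
      exact: tp_hom.
    by apply: funext => x; rewrite -hm; exact: t_nat.
  (* A homomorphism between the images comes, by fullness, from one between [M] and [N]. *)
  move=> /extend[k km]; have [h hk] := F_full M N k.
  suff -> : n = (h : structure_hom M N) \o m by exact: tp_hom.
  apply: funext => x; apply: (bij_inj (t_bij N)).
  have := t_nat M N h (m x); rewrite /= hk => ->.
  by have /(congr1 (@^~ x)) := km.
- move=> X Y f _ _ [M [m [-> ->]]]; exists M, (m \o f).
  by rewrite (tp_comp _ _ (@sm_models _ _ M)) (tp_comp _ _ (@sm_models _ _ (F M))).
Qed.

Theorem theorem6p6 (S S' : signature) (T : theory S) (T' : theory S')
    (hT : prime_types_realised T) (hT' : prime_types_realised T') :
  naturally_isomorphic (doctrine_delta T) (doctrine_delta T') <->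
  equivalent_over (forgetful T) (forgetful T').
Proof.
split=> [/correspondence_of_delta_iso[R]|]; first exact: equivalent_of_correspondence.
by move=> /(correspondence_of_equivalent hT hT')[R]; exact: delta_iso_of_correspondence.
Qed.
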